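(* Let $n\ge 2$ be an integer, $k,c_b>0$, $\rho_0>0$, and let $\lambda_{1,0},\dots,\lambda_{n,0}$ be real numbers with $\lambda_{1,0}=\cdots=\lambda_{J,0}<\lambda_{J+1,0}\le\cdots\le\lambda_{n,0}$ for some integer $1\le J\le n$. Consider the system $$\lambda_i'=-\lambda_i^2+\frac{k}{n}(\rho-c_b)\ (i=1,\dots,n),\qquad \rho'=-\rho\lambda,\quad \lambda=\sum_{i=1}^n\lambda_i,\qquad \rho(0)=\rho_0,\ \lambda_i(0)=\lambda_{i,0},$$ suppose its maximal interval of existence is $[0,t_B)$ with $0<t_B<\infty$, and let $u_i(t)=e^{\int_0^t\lambda_i(s)\,ds}$. If $J<j\le n$, then there exist constants $0\le q_j\le p_j$ such that $\lim_{t\to t_B^-}u_1'(t)u_j(t)=-p_j$ and $\lim_{t\to t_B^-}u_1(t)u_j'(t)=q_j$.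
   Context: Solutions are real-valued and continuously differentiable on $[0,t_B)$. *)

(* Defs.v *)
From Stdlib Require Import Reals Lra Lia.
From Coquelicot Require Import Coquelicot.
Open Scope R_scope.

Definition lamsum (n : nat) (lam : nat -> R -> R) (t : R) : R :=
  sum_n_m (fun i => lam i t) 1 n.

(* (lam, rho) solves the system on [0,T) with the given initial data:
   initial values, continuity (from the right) at 0, and the ODE on (0,T).
   Together with the ODE this makes the solution C^1 on [0,T). *)
Definition is_sol (n : nat) (k cb rho0 : R) (lam0 : nat -> R) (T : R)
    (lam : nat -> R -> R) (rho : R -> R) : Prop :=
  (forall i, (1 <= i <= n)%nat -> lam i 0 = lam0 i) /\
  rho 0 = rho0 /\
  (forall i, (1 <= i <= n)%nat -> filterlim (lam i) (at_right 0) (locally (lam i 0))) /\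
  filterlim rho (at_right 0) (locally (rho 0)) /\
  (forall t, 0 < t < T ->
     (forall i, (1 <= i <= n)%nat ->
        is_derive (lam i) t (- (lam i t)^2 + k / INR n * (rho t - cb))) /\
     is_derive rho t (- rho t * lamsum n lam t)).

Definition maximal_sol (n : nat) (k cb rho0 : R) (lam0 : nat -> R) (T : R)
    (lam : nat -> R -> R) (rho : R -> R) : Prop :=
  is_sol n k cb rho0 lam0 T lam rho /\
  ~ (exists T' lam' rho', T < T' /\ is_sol n k cb rho0 lam0 T' lam' rho' /\
       forall t, 0 <= t < T -> (forall i, (1 <= i <= n)%nat -> lam' i t = lam i t) /\ rho' t = rho t).

Definition u (lam : nat -> R -> R) (i : nat) (t : R) : R :=
  exp (RInt (lam i) 0 t).

(* Main.v *)
(* Put x = u_1 and W_i = lambda_(i,0) - lambda_(1,0).  All u_i solve the same linear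
   equation u'' = (k/n) (rho - c_b) u, so the Wronskian of u_1 and u_i is W_i and
   u_i = x (1 + W_i r) with r' = 1 / x^2.  As rho is rho_0 / (u_1 ... u_n), the system
   reduces to x'' = c x / (x^n Q(r)) - c' x, Q being a product of m = n - J affine
   factors.  An energy bound and maximality (the system is quadratic, so power series
   continue its solution whenever it converges) force x -> 0 and r -> infinity at t_B.

   Everything then follows from the convergence of h = - x x' r to some beta in
   [1/2, 1], with p_j = W_j beta and q_j = W_j (1 - beta).  In the clock s = ln r, with
   z = r x^2 and g = c r^2 x^4 / (x^n Q(r)),
     h_s = h (1 - h) - g + c' z^2,   g_s = g ((n - 4) h - (m - 2) + e),
     z_s = z (1 - 2 h),
   where e = O(1 / r), while h > 0 and, t_B being finite, z -> 0.  If g converges, h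
   follows a logistic equation whose root below 1/2 is excluded by z -> 0.  For n <= 4
   the limit of g is explicit, or its growth contradicts h > 0.  For n >= 5 and
   2 m <= n, g^2 z^(n-4) stays away from 0, which is absurd since g is bounded.  For
   n >= 5 and 2 m > n the system is an Emden-Fowler oscillator with positive damping
   about alpha = (m - 2) / (n - 4) > 1/2, and a Lyapunov function shows that g tends to
   0 or to alpha (1 - alpha). *)

Require Import Defs.
From Stdlib Require Import Reals Arith Lra Lia Classical.
From Coquelicot Require Import Coquelicot.
Open Scope R_scope.

(** * Limits from the left and differential inequalities *)

(** Why [h] decides everything: since [u_j = x (1 + W_j r)], one has [u_1' u_j = x x' - W_j h],
    where [x x' = - h / r] tends to 0, and the Wronskian turns [u_1 u_j'] into [W_j + u_1' u_j].
    Thus [q_j >= 0] amounts to [beta <= 1] and [q_j <= p_j] to [beta >= 1/2]. The limit [beta] is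
    the larger root of [y (1 - y) = lim g]: being the larger root puts it above [1/2], and
    [lim g >= 0] puts it below 1.

    The obstacle is that the equations for [h] and [g] are perturbed by [e] and [c' z^2], so they
    are not autonomous and phase plane arguments do not apply directly. The proof uses differential
    inequalities that need to hold only eventually. The change of clock is never carried out: every
    derivative is taken in [t] and written as [sg = s'] times the speed in the clock, and only
    [sg > 0] and [s -> infinity] are used. *)

Ltac rewrite_derive :=
  repeat match goal with |- context [Derive ?f ?t] =>
    rewrite (is_derive_unique f t _ ltac:(eassumption)) end.

Lemma at_left_iff (b : R) (P : R -> Prop) :
  at_left b P <-> exists a, a < b /\ forall t, a < t < b -> P t.
Proof.
  split.
  - intros [eps H]. exists (b - eps). split; [destruct eps; simpl; lra|].
    intros t Ht. apply H; [|lra].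
    change (Rabs (t - b) < eps). rewrite Rabs_left; lra.
  - intros [a [Ha H]]. exists (mkposreal (b - a) ltac:(lra)). intros t Ht Htb.
    apply H. change (Rabs (t - b) < b - a) in Ht.
    rewrite Rabs_left in Ht; lra.
Qed.

(** The usual end of a refutation below: eventual facts are intersected until they contradict each
    other at every late time. *)
Lemma at_left_false (b : R) : ~ at_left b (fun _ => False).
Proof. intros [a [Ha H]]%at_left_iff. apply (H ((a + b) / 2)). lra. Qed.

Lemma at_left_self (b a : R) : a < b -> at_left b (fun t => a < t < b).
Proof. intros H. apply at_left_iff. now exists a. Qed.

(** An epsilon form of [filterlim], so that a limit is directly an eventual bound that can be
    intersected with others. *)
Definition tends (b : R) (f : R -> R) (l : R) : Prop :=
  forall eps, 0 < eps -> at_left b (fun t => Rabs (f t - l) < eps).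

Lemma tends_filterlim (b : R) (f : R -> R) (l : R) :
  tends b f l <-> filterlim f (at_left b) (locally l).
Proof.
  split.
  - intros H. apply filterlim_locally. intros eps. apply (H eps). apply cond_pos.
  - intros H eps Heps.
    exact (proj1 (filterlim_locally f l) H (mkposreal eps Heps)).
Qed.

Lemma tends_const (b l : R) : tends b (fun _ => l) l.
Proof. apply tends_filterlim, filterlim_const. Qed.

Lemma tends_id (b : R) : tends b (fun t => t) b.
Proof.
  intros eps Heps. generalize (at_left_self b (b - eps) ltac:(lra)). apply filter_imp.
  intros t Ht. apply Rabs_def1; lra.
Qed.

Lemma tends_ext (b : R) (f g : R -> R) (l : R) :
  at_left b (fun t => f t = g t) -> tends b f l -> tends b g l.
Proof.
  intros H Hf eps Heps. generalize (filter_and _ _ H (Hf eps Heps)).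
  apply filter_imp. now intros t [<- H2].
Qed.

Lemma tends_continuous (b : R) (f g : R -> R) (l : R) :
  continuous g l -> tends b f l -> tends b (fun t => g (f t)) (g l).
Proof.
  intros Hg Hf%tends_filterlim. apply tends_filterlim.
  exact (filterlim_comp _ _ _ _ _ _ _ _ Hf Hg).
Qed.

Lemma tends_plus (b : R) (f g : R -> R) (l m : R) :
  tends b f l -> tends b g m -> tends b (fun t => f t + g t) (l + m).
Proof.
  intros Hf%tends_filterlim Hg%tends_filterlim. apply tends_filterlim.
  eapply filterlim_comp_2; [exact Hf|exact Hg|]. exact (filterlim_plus (V := R_NormedModule) l m).
Qed.

Lemma tends_mult (b : R) (f g : R -> R) (l m : R) :
  tends b f l -> tends b g m -> tends b (fun t => f t * g t) (l * m).
Proof.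
  intros Hf%tends_filterlim Hg%tends_filterlim. apply tends_filterlim.
  eapply filterlim_comp_2; [exact Hf|exact Hg|]. exact (filterlim_mult (K := R_AbsRing) l m).
Qed.

Lemma tends_scal (b c : R) (f : R -> R) (l : R) :
  tends b f l -> tends b (fun t => c * f t) (c * l).
Proof. apply tends_mult, tends_const. Qed.

Lemma tends_minus (b : R) (f g : R -> R) (l m : R) :
  tends b f l -> tends b g m -> tends b (fun t => f t - g t) (l - m).
Proof.
  intros Hf Hg. apply (tends_ext b (fun t => f t + -1 * g t)).
  - apply filter_forall. intros t. ring.
  - replace (l - m) with (l + -1 * m) by ring.
    now apply tends_plus, tends_scal.
Qed.

Lemma tends_lt (b : R) (f : R -> R) (l m : R) :
  tends b f l -> l < m -> at_left b (fun t => f t < m).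
Proof.
  intros Hf H. generalize (Hf (m - l) ltac:(lra)). apply filter_imp.
  intros t Ht%Rabs_def2. lra.
Qed.

Lemma tends_gt (b : R) (f : R -> R) (l m : R) :
  tends b f l -> m < l -> at_left b (fun t => m < f t).
Proof.
  intros Hf H. generalize (Hf (l - m) ltac:(lra)). apply filter_imp.
  intros t Ht%Rabs_def2. lra.
Qed.

Lemma tends_squeeze_0 (b : R) (f g : R -> R) :
  at_left b (fun t => 0 <= f t <= g t) -> tends b g 0 -> tends b f 0.
Proof.
  intros H Hg eps Heps. generalize (filter_and _ _ H (Hg eps Heps)).
  apply filter_imp. intros t [H1 H2%Rabs_def2]. apply Rabs_def1; lra.
Qed.

Lemma tends_inv_infty (b : R) (f : R -> R) :
  (forall M, at_left b (fun t => M < f t)) -> tends b (fun t => / f t) 0.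
Proof.
  intros H eps Heps. generalize (filter_and _ _ (H 0) (H (/ eps))).
  apply filter_imp. intros t [H1 H2].
  rewrite Rminus_0_r, Rabs_pos_eq by (left; now apply Rinv_0_lt_compat).
  rewrite <- (Rinv_inv eps). apply Rinv_lt_contravar; [|easy].
  apply Rmult_lt_0_compat; [now apply Rinv_0_lt_compat|easy].
Qed.

Lemma nonincreasing_of_derive (a b : R) (f df : R -> R) :
  (forall t, a < t < b -> is_derive f t (df t)) ->
  (forall t, a < t < b -> df t <= 0) ->
  forall s t, a < s <= t -> t < b -> f t <= f s.
Proof.
  intros Hf Hd s t Hs Ht. destruct (Req_dec s t) as [->|Hne]; [lra|].
  destruct (MVT_cor2 f df s t) as [c [Hc1 Hc2]]; [lra| |].
  - intros c Hc. apply is_derive_Reals, Hf. lra.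
  - assert (df c <= 0) by (apply Hd; lra). nra.
Qed.

Lemma nonincreasing_tends (a b m : R) (f : R -> R) : a < b ->
  (forall s t, a < s <= t -> t < b -> f t <= f s) ->
  (forall t, a < t < b -> m <= f t) -> exists l, tends b f l.
Proof.
  intros Hab Hf Hm.
  destruct (completeness (fun y => exists t, a < t < b /\ y = - f t)) as [l [Hl1 Hl2]].
  - exists (- m). intros y [t [Ht ->]]. specialize (Hm t Ht). lra.
  - exists (- f ((a + b) / 2)), ((a + b) / 2). split; [lra|easy].
  - exists (- l). intros eps Heps.
    destruct (classic (exists t, a < t < b /\ l - eps < - f t)) as [[t [Ht Hlt]]|Hn].
    + apply at_left_iff. exists t. split; [lra|]. intros s Hs.
      assert (f s <= f t) by (apply Hf; lra).
      assert (- f s <= l) by (apply Hl1; exists s; split; [lra|easy]).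
      apply Rabs_def1; lra.
    + exfalso. assert (l <= l - eps); [|lra]. apply Hl2. intros y [t [Ht ->]].
      apply Rnot_lt_le. intros Hlt. apply Hn. now exists t.
Qed.

(** Just after the last time [c] with [f c <= L], continuity keeps [f] inside the strip of height
    [eta], and there the mean value theorem forbids growth. The sign of the derivative in a thin
    strip is therefore enough; nothing has to be known higher up. *)
Lemma barrier (a b L eta : R) (f df : R -> R) : 0 < eta ->
  (forall t, a < t < b -> is_derive f t (df t)) ->
  (forall t, a < t < b -> L < f t < L + eta -> df t <= 0) ->
  forall s t, a < s <= t -> t < b -> f s <= L -> f t <= L.
Proof.
  intros Heta Hf Hd s t Hs Ht Hfs. apply Rnot_lt_le. intros Hft.
  assert (Hcont : forall c, a < c < b -> continuity_pt f c).
  { intros c Hc. apply continuity_pt_filterlim.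
    apply (ex_derive_continuous f c). exists (df c). now apply Hf. }
  destruct (completeness (fun c => s <= c <= t /\ f c <= L)) as [c [Hc1 Hc2]].
  - exists t. intros c Hc. lra.
  - exists s. split; [lra|easy].
  - assert (Hsc : s <= c) by (apply Hc1; split; [lra|easy]).
    assert (Hct : c <= t) by (apply Hc2; intros y Hy; lra).
    assert (Hfc : f c <= L).
    { apply Rnot_lt_le. intros Hlt.
      destruct (Hcont c ltac:(lra) (f c - L) ltac:(lra)) as [d [Hd0 Hd1]].
      assert (c <= c - d); [|lra]. apply Hc2. intros y [Hy1 Hy2].
      apply Rnot_lt_le. intros Hlt'.
      assert (Hyc : y <= c) by (apply Hc1; split; easy).
      destruct (Req_dec y c) as [->|Hne]; [lra|].
      assert (Rabs (f y - f c) < f c - L) as Hab.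
      { apply Hd1. split; [split; [exact I|lra]|].
        simpl. unfold R_dist. rewrite Rabs_left; lra. }
      apply Rabs_def2 in Hab. lra. }
    assert (Hct' : c < t) by (destruct Hct as [?| ->]; lra).
    destruct (Hcont c ltac:(lra) eta Heta) as [d [Hd0 Hd1]].
    set (t' := Rmin t (c + d / 2)).
    assert (Ht' : c < t' <= t /\ t' < c + d).
    { unfold t'. split; [split|]; [apply Rmin_glb_lt; lra|apply Rmin_l|].
      eapply Rle_lt_trans; [apply Rmin_r|lra]. }
    assert (Habove : forall y, c < y <= t -> L < f y).
    { intros y Hy. apply Rnot_le_lt. intros Hle.
      assert (y <= c); [|lra]. apply Hc1. split; [lra|easy]. }
    destruct (MVT_cor2 f df c t') as [xi [Hx1 Hx2]]; [lra| |].
    + intros y Hy. apply is_derive_Reals, Hf. lra.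
    + assert (df xi <= 0).
      { apply Hd; [lra|]. split; [apply Habove; lra|].
        assert (Rabs (f xi - f c) < eta) as Hab.
        { apply Hd1. split; [split; [exact I|lra]|].
          simpl. unfold R_dist. rewrite Rabs_pos_eq; lra. }
        apply Rabs_def2 in Hab. lra. }
      assert (L < f t') by (apply Habove; lra). nra.
Qed.

(** * Comparison principles in a clock [s] of speed [sg] *)

Section Clock.

Context (b : R) (s sg : R -> R).
Hypothesis s_derive : at_left b (fun t => is_derive s t (sg t)).
Hypothesis sg_pos : at_left b (fun t => 0 < sg t).
Hypothesis s_infty : forall M, at_left b (fun t => M < s t).

(** [f + delta * s] is nonincreasing near [b], while [s] grows without bound. *)
Lemma clock_to_minus_infty (f df : R -> R) (delta : R) : 0 < delta ->
  at_left b (fun t => is_derive f t (df t)) ->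
  at_left b (fun t => df t <= - delta * sg t) ->
  forall M, at_left b (fun t => f t < M).
Proof.
  intros Hdel Hf Hd M.
  destruct (proj1 (at_left_iff _ _) (filter_and _ _ s_derive (filter_and _ _ Hf Hd)))
    as [a [Hab Ha]].
  set (c := (a + b) / 2).
  generalize (filter_and _ _ (s_infty (s c + (f c - M) / delta)) (at_left_self b c ltac:(unfold c; lra))).
  apply filter_imp. intros t [Ht1 Ht2].
  assert (f t + delta * s t <= f c + delta * s c).
  { apply (nonincreasing_of_derive a b (fun t => f t + delta * s t)
             (fun t => df t + delta * sg t)); unfold c in *; try lra.
    - intros y Hy. destruct (Ha y Hy) as [H1 [H2 _]].
      apply (is_derive_plus (V := R_NormedModule)); [easy|]. now apply is_derive_scal.
    - intros y Hy. destruct (Ha y Hy) as [H1 [H2 H3]]. lra. }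
  assert (delta * ((f c - M) / delta) = f c - M) by (field; lra). nra.
Qed.

(** Either [f] reaches [L] at some late time and [barrier] holds it there, or it stays above [L] and
    the clock drives it to minus infinity, which is absurd. *)
Lemma trap (f df : R -> R) (delta L : R) : 0 < delta ->
  at_left b (fun t => is_derive f t (df t)) ->
  at_left b (fun t => L <= f t -> df t <= - delta * sg t) ->
  at_left b (fun t => f t <= L).
Proof.
  intros Hdel Hf Hd.
  destruct (proj1 (at_left_iff _ _) (filter_and _ _ sg_pos (filter_and _ _ Hf Hd)))
    as [a [Hab Ha]].
  destruct (classic (exists t, a < t < b /\ f t <= L)) as [[t [Ht Hft]]|Hn].
  - apply at_left_iff. exists t. split; [lra|]. intros y Hy.
    apply (barrier a b L 1 f df) with (s := t); try lra.
    + intros c Hc. now apply Ha.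
    + intros c Hc Hfc. destruct (Ha c Hc) as [H1 [H2 H3]].
      specialize (H3 ltac:(lra)). nra.
  - exfalso. apply (at_left_false b).
    assert (HL : forall t, a < t < b -> L < f t).
    { intros t Ht. apply Rnot_le_lt. intros H. apply Hn. now exists t. }
    assert (Hm := clock_to_minus_infty f df delta Hdel Hf).
    assert (Hd' : at_left b (fun t => df t <= - delta * sg t)).
    { apply at_left_iff. exists a. split; [easy|]. intros t Ht.
      apply Ha; [easy|]. left. now apply HL. }
    generalize (filter_and _ _ (Hm Hd' L) (at_left_self b a Hab)).
    apply filter_imp. intros t [H1 H2]. specialize (HL t H2). lra.
Qed.

(* [f^3] is, up to a monotone correction by [E], monotone; so [f^3] converges,
   and a nonzero limit would drive [E] to minus infinity. *)
Lemma barbalat (E dE f df : R -> R) (k B m : R) : 0 < k ->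
  at_left b (fun t => is_derive E t (dE t)) ->
  at_left b (fun t => is_derive f t (df t)) ->
  at_left b (fun t => dE t <= - k * (f t)^2 * sg t) ->
  at_left b (fun t => Rabs (df t) <= B * sg t) ->
  at_left b (fun t => m <= E t) ->
  at_left b (fun t => Rabs (f t) <= B) ->
  tends b f 0.
Proof.
  intros Hk HE Hf HdE Hdf Hm HB.
  destruct (proj1 (at_left_iff _ _) (filter_and _ _ sg_pos (filter_and _ _ HE (filter_and _ _ Hf
    (filter_and _ _ HdE (filter_and _ _ Hdf (filter_and _ _ Hm HB))))))) as [a [Hab Ha]].
  assert (HB0 : 0 <= B).
  { destruct (Ha ((a + b) / 2) ltac:(lra)) as (_&_&_&_&_&_&H).
    pose proof (Rabs_pos (f ((a + b) / 2))). lra. }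
  (* The cube is chosen because its derivative [3 f^2 df] carries the factor [f^2] of the
     dissipation: it is at most [3 B f^2 sg = K k f^2 sg], which [- K dE] dominates. *)
  set (K := 3 * B / k).
  assert (HK : K * k = 3 * B) by (unfold K; field; lra).
  assert (HK0 : 0 <= K) by (unfold K; apply Rmult_le_pos; [lra|left; now apply Rinv_0_lt_compat]).
  assert (Hsq : forall t, a < t < b -> 0 <= (f t)^2 /\ Rabs (df t * (f t)^2) <= B * sg t * (f t)^2).
  { intros t Ht. split; [apply pow2_ge_0|]. rewrite Rabs_mult, (Rabs_pos_eq ((f t)^2)) by apply pow2_ge_0.
    apply Rmult_le_compat_r; [apply pow2_ge_0|]. now apply Ha. }
  assert (Hf3 : forall t, a < t < b -> - B^3 <= (f t)^3 <= B^3).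
  { intros t Ht. destruct (Ha t Ht) as (_&_&_&_&_&_&H).
    apply Rabs_le_between in H. generalize dependent (f t). intros y Hy.
    assert (0 <= (B - y) * (B^2 + B * y + y^2)) by (apply Rmult_le_pos; nra).
    assert (0 <= (B + y) * (B^2 - B * y + y^2)) by (apply Rmult_le_pos; nra). lra. }
  destruct (nonincreasing_tends a b m E Hab) as [lE HlE].
  { apply nonincreasing_of_derive with dE; intros t Ht; [now apply Ha|].
    destruct (Ha t Ht) as (H1&_&_&H2&_). pose proof (pow2_ge_0 (f t)).
    assert (0 <= k * f t ^ 2 * sg t); [|lra].
    apply Rmult_le_pos; [apply Rmult_le_pos; lra|lra]. }
  { intros t Ht. now apply Ha. }
  destruct (nonincreasing_tends a b (K * m - B^3) (fun t => K * E t + (f t)^3) Hab) as [l3 Hl3].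
  { apply nonincreasing_of_derive with (fun t => K * dE t + df t * (3 * (f t)^2)); intros t Ht;
    destruct (Ha t Ht) as (H1&H2&H3&H4&H5&_).
    - apply (is_derive_plus (V := R_NormedModule)); [now apply is_derive_scal|].
      apply (is_derive_comp (fun y => y^3) f t); [|easy].
      evar_last; [apply is_derive_pow, is_derive_id|simpl; unfold one; simpl; ring].
    - destruct (Hsq t Ht) as [H6 H7]. apply Rabs_le_between in H7.
      assert (K * dE t <= K * (- k * f t ^ 2 * sg t)) by (apply Rmult_le_compat_l; lra).
      replace (K * (- k * f t ^ 2 * sg t)) with (- (K * k) * (f t ^ 2 * sg t)) in H by ring.
      rewrite HK in H. nra. }
  { intros t Ht. destruct (Ha t Ht) as (_&_&_&_&_&H&_). specialize (Hf3 t Ht).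
    assert (K * m <= K * E t) by (apply Rmult_le_compat_l; lra). lra. }
  set (L := l3 - K * lE).
  assert (HL : tends b (fun t => (f t)^3) L).
  { apply (tends_ext b (fun t => (K * E t + (f t)^3) - K * E t)).
    - apply filter_forall. intros t. ring.
    - now apply tends_minus, tends_scal. }
  assert (HL0 : L = 0).
  { apply NNPP. intros Hne.
    assert (HLp : 0 < Rabs L) by now apply Rabs_pos_lt.
    apply (at_left_false b).
    (* Capping [e] at 1 avoids cube roots: [|f| < e] would give [|f|^3 <= |f| < |L| / 2]. *)
    set (e := Rmin 1 (Rabs L / 2)).
    assert (He : 0 < e <= 1 /\ e <= Rabs L / 2).
    { unfold e. split; [split; [apply Rmin_glb_lt; lra|apply Rmin_l]|apply Rmin_r]. }
    assert (Hfe : at_left b (fun t => e^2 <= (f t)^2)).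
    { generalize (HL (Rabs L / 2) ltac:(lra)). apply filter_imp. intros t Ht.
      assert (Rabs L / 2 < Rabs (f t ^ 3)).
      { pose proof (Rabs_triang_inv L (f t ^ 3)) as H1.
        rewrite Rabs_minus_sym in H1. lra. }
      rewrite <- RPow_abs in H. rewrite <- (pow2_abs (f t)).
      apply pow_incr. split; [lra|]. apply Rnot_lt_le. intros Hlt.
      pose proof (Rabs_pos (f t)).
      assert (Rabs (f t) ^ 3 <= Rabs (f t)); [|lra].
      assert (Rabs (f t)^2 <= 1) by nra. simpl in *. nra. }
    assert (Hmin := clock_to_minus_infty E dE (k * e^2) ltac:(apply Rmult_lt_0_compat; [lra|apply pow_lt; lra]) HE).
    assert (HdE' : at_left b (fun t => dE t <= - (k * e ^ 2) * sg t)).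
    { generalize (filter_and _ _ Hfe (filter_and _ _ HdE sg_pos)). apply filter_imp.
      intros t (H1&H2&H3). eapply Rle_trans; [exact H2|].
      assert (k * e^2 * sg t <= k * f t ^ 2 * sg t); [|lra].
      apply Rmult_le_compat_r; [lra|]. apply Rmult_le_compat_l; lra. }
    generalize (filter_and _ _ (Hmin HdE' m) Hm). apply filter_imp. intros t [H1 H2]. lra. }
  rewrite HL0 in HL. intros eps Heps.
  generalize (HL (eps^3) ltac:(apply pow_lt; lra)). apply filter_imp. intros t Ht.
  rewrite Rminus_0_r in *. rewrite <- RPow_abs in Ht.
  apply Rnot_le_lt. intros Hle. apply (Rlt_irrefl (eps^3)).
  eapply Rle_lt_trans; [|exact Ht]. apply pow_incr. lra.
Qed.

End Clock.

(** * The oscillator *)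

Lemma speed_le (sg K del : R) : 0 < sg -> K <= - del -> sg * K <= - del * sg.
Proof. intros H1 H2. nra. Qed.

Section Dynamics.

Context (b : R) (s sg : R -> R).
Hypothesis s_derive : at_left b (fun t => is_derive s t (sg t)).
Hypothesis sg_pos : at_left b (fun t => 0 < sg t).
Hypothesis s_infty : forall M, at_left b (fun t => M < s t).

(* [y = h - 1/2] follows [y' = r^2 - y^2] up to an error tending to zero; the
   decay of [z] excludes the repelling root [-r]. *)
Lemma logistic_limit (h g d z : R -> R) (gi : R) :
  at_left b (fun t => is_derive h t (sg t * (h t * (1 - h t) - g t + d t))) ->
  at_left b (fun t => is_derive z t (sg t * (z t * (1 - 2 * h t)))) ->
  at_left b (fun t => 0 < h t) -> at_left b (fun t => 0 < z t) ->
  tends b z 0 -> tends b g gi -> tends b d 0 -> 0 <= gi ->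
  exists beta, 1/2 <= beta <= 1 /\ tends b h beta.
Proof.
  intros Hh Hz Hhp Hzp Hz0 Hg Hd Hgi.
  set (e := fun t => d t - (g t - gi)).
  assert (He : tends b e 0).
  { replace 0 with (0 - (gi - gi)) by ring. unfold e.
    apply tends_minus, tends_minus, tends_const; easy. }
  set (dh := fun t => sg t * (h t * (1 - h t) - g t + d t)).
  change (at_left b (fun t => is_derive h t (dh t))) in Hh.
  (* [1/4] is the maximum of [y (1 - y)]. If [gi] exceeds it, the speed of [h] is eventually below a
     negative constant, against [h > 0]. *)
  destruct (Rlt_le_dec (1/4) gi) as [Hlt|Hle].
  - exfalso. apply (at_left_false b).
    assert (H : at_left b (fun t => dh t <= - ((gi - 1/4) / 2) * sg t)).
    { generalize (filter_and _ _ sg_pos (He ((gi - 1/4) / 2) ltac:(lra))).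
      apply filter_imp. intros t [H1 H2%Rabs_def2]. unfold dh, e in *.
      assert (h t * (1 - h t) <= 1/4) by (pose proof (pow2_ge_0 (h t - 1/2)); lra).
      apply speed_le; lra. }
    generalize (filter_and _ _ Hhp
      (clock_to_minus_infty b s sg s_derive s_infty h dh ((gi - 1/4) / 2) ltac:(lra) Hh H 0)).
    apply filter_imp. intros t Ht. lra.
  (* The roots of [y (1 - y) = gi] are [1/2 - r] and [1/2 + r]; [gi >= 0] gives [r <= 1/2]. *)
  - set (r := sqrt (1/4 - gi)).
    assert (Hr0 : 0 <= r) by apply sqrt_pos.
    assert (Hr2 : r * r = 1/4 - gi) by (apply sqrt_sqrt; lra).
    assert (Hdh : forall t, dh t = sg t * (r * r - (h t - 1/2)^2 + e t)).
    { intros t. unfold dh, e. rewrite Hr2. field. }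
    clearbody dh. clearbody e. clear Hg Hd g d.
    exists (1/2 + r). split; [assert (r <= 1/2) by (apply Rnot_lt_le; intros ?; nra); lra|].
    assert (Hup : forall eps, 0 < eps -> at_left b (fun t => h t <= 1/2 + r + eps)).
    { intros eps Heps.
      apply (trap b s sg s_derive sg_pos s_infty h dh (eps * eps / 2)); [nra|easy|].
      generalize (filter_and _ _ sg_pos (He (eps * eps / 2) ltac:(nra))).
      apply filter_imp. intros t [H1 H2%Rabs_def2] H3. rewrite Hdh.
      assert ((r + eps) * (r + eps) <= (h t - 1/2)^2) by nra.
      apply speed_le; nra. }
    assert (Hlow : forall eps, 0 < eps -> at_left b (fun t => 1/2 + r - eps <= h t)).
    (* If the roots merge, a drop below [1/2 - eps] would be irreversible and [h] would fall past 0;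
       the decay of [z] is used only for [r > 0]. *)
    { destruct (Req_dec r 0) as [Hr|Hr].
      - intros eps Heps. apply NNPP. intros Hn.
        destruct (proj1 (at_left_iff _ _) (filter_and _ _ sg_pos (filter_and _ _ Hh
          (filter_and _ _ Hhp (He (eps * eps / 2) ltac:(nra)))))) as [a [Hab Ha]].
        assert (Ht : exists t, a < t < b /\ h t < 1/2 + r - eps).
        { apply NNPP. intros Hn'. apply Hn. apply at_left_iff. exists a. split; [easy|].
          intros t Ht. apply Rnot_lt_le. intros H. apply Hn'. now exists t. }
        destruct Ht as [t [Ht Hht]].
        assert (Hstay : forall y, t <= y < b -> h y <= 1/2 + r - eps).
        { intros y Hy. apply (barrier a b _ (eps / 4) h dh) with (s := t); try lra.
          - intros c Hc. now apply Ha.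
          - intros c Hc Hhc. rewrite Hdh. destruct (Ha c Hc) as (H1&_&_&H2%Rabs_def2).
            assert ((3/4 * eps)^2 <= (1/2 - h c)^2) by (apply pow_incr; lra).
            assert (0 < eps * eps) by nra. nra. }
        apply (at_left_false b).
        assert (H : at_left b (fun t => dh t <= - (eps * eps / 2) * sg t)).
        { apply at_left_iff. exists t. split; [lra|]. intros c Hc. rewrite Hdh.
          destruct (Ha c ltac:(lra)) as (H1&_&_&H2%Rabs_def2).
          specialize (Hstay c ltac:(lra)).
          assert (eps * eps <= (h c - 1/2)^2) by nra. rewrite Hr. apply speed_le; lra. }
        generalize (filter_and _ _ Hhp
          (clock_to_minus_infty b s sg s_derive s_infty h dh (eps * eps / 2) ltac:(nra) Hh H 0)).
        apply filter_imp. intros c Hc. lra.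
      - assert (Hr' : 0 < r) by lra.
        destruct (proj1 (at_left_iff _ _) (filter_and _ _ sg_pos (filter_and _ _ Hh
          (filter_and _ _ Hz (filter_and _ _ Hzp (He (r * r / 2) ltac:(nra))))))) as [a [Hab Ha]].
        (* While [h <= 1/2], [z] does not decrease, so [z -> 0] forces [h] above [1/2] at some
           time. *)
        assert (Ht : exists t, a < t < b /\ 1/2 < h t).
        { apply NNPP. intros Hn. apply (at_left_false b).
          set (c := (a + b) / 2).
          destruct (Ha c ltac:(unfold c; lra)) as (_&_&_&Hzc&_).
          generalize (filter_and _ _ (tends_lt b z 0 (z c) Hz0 Hzc)
            (at_left_self b c ltac:(unfold c; lra))).
          apply filter_imp. intros t [H1 H2].
          assert (- z t <= - z c); [|lra].
          apply (nonincreasing_of_derive a b (fun t => - z t)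
            (fun t => - (sg t * (z t * (1 - 2 * h t))))); unfold c in *; try lra.
          - intros y Hy. apply (is_derive_opp (V := R_NormedModule)). now apply Ha.
          - intros y Hy. destruct (Ha y Hy) as (H3&_&_&H4&_).
            assert (h y <= 1/2) by (apply Rnot_lt_le; intros H; apply Hn; now exists y).
            assert (0 <= sg y * (z y * (1 - 2 * h y))); [|lra].
            apply Rmult_le_pos; [lra|]. apply Rmult_le_pos; lra. }
        destruct Ht as [t [Ht Hht]].
        (* Near [1/2] the field is close to [r^2 > 0], so [h] cannot cross back; this cuts off the
           repelling root. *)
        assert (Hstay : forall y, t <= y < b -> 1/2 <= h y).
        { intros y Hy. cut (- h y <= -(1/2)); [lra|].
          apply (barrier a b _ (r / 2) (fun t => - h t) (fun t => - dh t)) with (s := t); try lra.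
          - intros c Hc. apply (is_derive_opp (V := R_NormedModule)). now apply Ha.
          - intros c Hc Hhc. rewrite Hdh. destruct (Ha c Hc) as (H1&_&_&_&H2%Rabs_def2).
            assert ((1/2 - h c)^2 <= (r/2)^2) by (apply pow_incr; lra). nra. }
        assert (Hsmall : forall eps, 0 < eps <= r -> at_left b (fun t => 1/2 + r - eps <= h t)).
        { intros eps Heps.
          cut (at_left b (fun t => - h t <= - (1/2 + r - eps))).
          { apply filter_imp. intros c Hc. lra. }
          (* On [1/2 <= h <= 1/2 + r - eps] the field is at least [2 r eps - eps^2 - eps r / 2],
             hence at least [eps r / 2] as [eps <= r]. *)
          apply (trap b s sg s_derive sg_pos s_infty (fun t => - h t) (fun t => - dh t) (eps * r / 2)).
          - nra.
          - revert Hh. apply filter_imp. intros c Hc.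
            now apply (is_derive_opp (V := R_NormedModule)).
          - assert (H1 := at_left_self b t ltac:(lra)).
            assert (H2 := He (eps * r / 2) ltac:(nra)).
            generalize (filter_and _ _ sg_pos (filter_and _ _ H1 H2)). clear H1 H2.
            apply filter_imp. intros c (H1&H3&H2%Rabs_def2) H4. rewrite Hdh.
            specialize (Hstay c ltac:(lra)).
            assert ((h c - 1/2)^2 <= (r - eps)^2) by (apply pow_incr; lra).
            assert (eps * r / 2 <= r * r - (h c - 1/2)^2 + e c) by nra. nra. }
        intros eps Heps. destruct (Rle_dec eps r) as [H|H].
        + apply Hsmall. lra.
        + generalize (Hsmall r ltac:(lra)). apply filter_imp. intros c Hc. lra. }
    intros eps Heps. assert (Heps2 : 0 < eps / 2) by lra.
    generalize (filter_and _ _ (Hup _ Heps2) (Hlow _ Heps2)).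
    apply filter_imp. intros t Ht. apply Rabs_def1; lra.
Qed.

(* [M E - p phi + B rr] with [p = w (h - al)], [phi = w (al (1 - al) - g)] and
   [E = p^2/2 - al (1 - al) w^2/2 + g w^2/(N+2) + d w^2/2], the energy of the
   Emden-Fowler oscillator satisfied by [w], is a strict Lyapunov function. *)
Lemma emden_fowler_phi (h g d e rr w : R -> R) (N al A G W Hb : R) :
  0 < N -> 1/2 < al -> 0 <= A ->
  at_left b (fun t => is_derive h t (sg t * (h t * (1 - h t) - g t + d t))) ->
  at_left b (fun t => is_derive g t (sg t * (g t * (N * (h t - al) + e t)))) ->
  at_left b (fun t => is_derive d t (sg t * (2 * d t * (1 - 2 * h t)))) ->
  at_left b (fun t => is_derive rr t (sg t * - rr t)) ->
  at_left b (fun t => is_derive w t (sg t * (w t * (h t - al)))) ->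
  at_left b (fun t => 0 < h t <= Hb) -> at_left b (fun t => 0 < g t <= G) ->
  at_left b (fun t => 0 <= d t <= 1) -> at_left b (fun t => 0 < rr t <= 1) ->
  at_left b (fun t => 0 <= e t <= A * rr t) -> at_left b (fun t => 0 < w t <= W) ->
  tends b (fun t => w t * (al * (1 - al) - g t)) 0.
Proof.
  intros HN Hal HA Hh Hg Hd Hrr Hw Hhb Hgb Hdb Hrb Heb Hwb.
  set (gs := al * (1 - al)).
  assert (HGp : 0 < G).
  { apply Rnot_le_lt. intros H. apply (at_left_false b). revert Hgb. apply filter_imp. intros; lra. }
  assert (HWp : 0 < W).
  { apply Rnot_le_lt. intros H. apply (at_left_false b). revert Hwb. apply filter_imp. intros; lra. }
  assert (HHp : 0 < Hb).
  { apply Rnot_le_lt. intros H. apply (at_left_false b). revert Hhb. apply filter_imp. intros; lra. }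
  (* [b1] is the damping: in the clock, [p = w'] and [p' = - b1 p + phi + d w]. As [g] varies like
     [w^N] up to [e], the force [- g w] has potential [g w^2 / (N + 2)]; and since [d] varies at the
     rate [2 (1 - 2 h)], the term [d w^2 / 2] turns the forcing [d w] into a further loss
     [- b1 d w^2]. *)
  set (b1 := 2 * al - 1). assert (Hb1 : 0 < b1) by (unfold b1; lra).
  set (P := W * (Hb + al)).
  (* [M] pays for what the correction [- p phi] creates: [b1^2] for [b1 p phi], [|gs| + (N + 1) G]
     for the derivative of [phi], and 1 for [w d phi]. *)
  set (M := (b1 * b1 + Rabs gs + (N + 1) * G + 1) / b1).
  assert (HMb : M * b1 = b1 * b1 + Rabs gs + (N + 1) * G + 1) by (unfold M; field; lra).
  pose proof (Rabs_pos gs) as Hgs0.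
  assert (HM : 0 < M).
  { unfold M. apply Rdiv_lt_0_compat; [|easy]. nra. }
  (* The term [B rr] decays at the speed [B rr], which absorbs both terms containing [e <= A rr]. *)
  set (B := A * (M * (G * W^2) / (N + 2) + P * (W * G))).
  set (p := fun t => w t * (h t - al)).
  set (phi := fun t => w t * (gs - g t)).
  set (dphi := fun t => sg t * (p t * (gs - g t) - w t * (g t * (N * (h t - al) + e t)))).
  set (E := fun t => M * ((p t)^2 / 2 - gs * (w t)^2 / 2 + g t * (w t)^2 / (N + 2) + d t * (w t)^2 / 2)
                     - p t * phi t + B * rr t).
  set (dE := fun t => sg t * (
     M * (- b1 * (p t)^2 - b1 * d t * (w t)^2 + e t * g t * (w t)^2 / (N + 2))
     + b1 * p t * phi t - (phi t)^2 - w t * d t * phi t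
     - (p t)^2 * (gs - (N + 1) * g t) + p t * w t * g t * e t - B * rr t)).
  set (All := filter_and _ _ sg_pos (filter_and _ _ Hhb (filter_and _ _ Hgb (filter_and _ _ Hdb
     (filter_and _ _ Hrb (filter_and _ _ Heb Hwb)))))).
  assert (HP : forall t, 0 < h t <= Hb -> 0 < w t <= W -> Rabs (p t) <= P).
  { intros t H1 H2. unfold p, P. rewrite Rabs_mult, (Rabs_pos_eq (w t)) by lra.
    apply Rmult_le_compat; try lra; [apply Rabs_pos|].
    apply Rabs_le. lra. }
  assert (Hphi : forall t, 0 < g t <= G -> 0 < w t <= W -> Rabs (phi t) <= W * (Rabs gs + G)).
  { intros t H1 H2. unfold phi. rewrite Rabs_mult, (Rabs_pos_eq (w t)) by lra.
    apply Rmult_le_compat; try lra; [apply Rabs_pos|].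
    unfold Rminus. eapply Rle_trans; [apply Rabs_triang|].
    rewrite Rabs_Ropp, (Rabs_pos_eq (g t)); lra. }
  assert (HP0 : 0 <= P) by (unfold P; apply Rmult_le_pos; lra).
  set (C1 := P * (Rabs gs + G) + W * (G * (N * (Hb + al) + A))).
  (* [barbalat] takes a single bound for [phi] and for its speed. *)
  set (C := Rmax C1 (W * (Rabs gs + G))).
  apply (barbalat b s sg s_derive sg_pos s_infty E dE phi dphi (1/2) C
    (- M * Rabs gs * W^2 / 2 - P * (W * (Rabs gs + G)))); [lra| | | | | |].
  - generalize (filter_and _ _ Hh (filter_and _ _ Hg (filter_and _ _ Hd (filter_and _ _ Hrr Hw)))).
    apply filter_imp. intros t (H1&H2&H3&H4&H5). unfold E, p, phi.
    auto_derive.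
    + repeat split; (eexists; eassumption) || exact I.
    + repeat match goal with |- context [Derive ?f t] =>
        rewrite (is_derive_unique f t _ ltac:(eassumption)) end.
      unfold dE, p, phi, gs, b1. field. lra.
  - generalize (filter_and _ _ Hg Hw).
    apply filter_imp. intros t (H1&H2). unfold phi.
    auto_derive.
    + repeat split; (eexists; eassumption) || exact I.
    + repeat match goal with |- context [Derive ?f t] =>
        rewrite (is_derive_unique f t _ ltac:(eassumption)) end.
      unfold dphi, p. ring.
  - generalize All. apply filter_imp. intros t (H0&H1&H2&H3&H4&H5&H6).
    assert (Hp := HP t H1 H6).
    assert (HK : M * (- b1 * (p t)^2 - b1 * d t * (w t)^2 + e t * g t * (w t)^2 / (N + 2))
     + b1 * p t * phi t - (phi t)^2 - w t * d t * phi t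
     - (p t)^2 * (gs - (N + 1) * g t) + p t * w t * g t * e t - B * rr t <= - (1/2) * (phi t)^2).
    { assert (Ha : M * (e t * g t * (w t)^2 / (N + 2)) + p t * w t * g t * e t <= B * rr t).
      { unfold B.
        assert (Hgw : 0 <= g t * w t ^ 2 <= G * W^2).
        { split; [apply Rmult_le_pos; [lra|apply pow2_ge_0]|].
          apply Rmult_le_compat; try lra; [apply pow2_ge_0|apply pow_incr; lra]. }
        assert (Hpw : p t * (w t * g t) <= P * (W * G)).
        { eapply Rle_trans; [apply Rle_abs|]. rewrite Rabs_mult, (Rabs_pos_eq (w t * g t)) by nra.
          apply Rmult_le_compat; try easy; [apply Rabs_pos|nra|nra]. }
        replace (M * (e t * g t * w t ^ 2 / (N + 2)) + p t * w t * g t * e t) with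
          (e t * (M * (g t * w t ^ 2) / (N + 2) + p t * (w t * g t))) by (field; lra).
        replace (A * (M * (G * W ^ 2) / (N + 2) + P * (W * G)) * rr t) with
          ((A * rr t) * (M * (G * W ^ 2) / (N + 2) + P * (W * G))) by ring.
        assert (Hm : M * (g t * w t ^ 2) / (N + 2) <= M * (G * W ^ 2) / (N + 2)).
        { apply Rmult_le_compat_r; [left; apply Rinv_0_lt_compat; lra|].
          apply Rmult_le_compat_l; lra. }
        assert (0 <= M * (G * W ^ 2) / (N + 2) + P * (W * G)).
        { apply Rplus_le_le_0_compat; [apply Rmult_le_pos; [apply Rmult_le_pos; lra|left; apply Rinv_0_lt_compat; lra]|].
          apply Rmult_le_pos; [lra|]. apply Rmult_le_pos; lra. }
        eapply Rle_trans; [apply Rmult_le_compat_l; [lra|apply Rplus_le_compat; [exact Hm|exact Hpw]]|].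
        apply Rmult_le_compat_r; lra. }
      (* This and the next inequality are Young's, at a cost of [phi^2 / 4] each; half of the
         dissipation [phi^2] is left. *)
      assert (Hb' : b1 * p t * phi t <= phi t ^ 2 / 4 + b1 * b1 * p t ^ 2)
        by (pose proof (pow2_ge_0 (phi t / 2 - b1 * p t)); nra).
      assert (Hc : - (w t * d t * phi t) <= phi t ^ 2 / 4 + d t * w t ^ 2).
      { pose proof (pow2_ge_0 (phi t / 2 + w t * d t)).
        assert (d t * d t * w t ^ 2 <= d t * w t ^ 2) by
          (apply Rmult_le_compat_r; [apply pow2_ge_0|nra]). nra. }
      assert (Hd' : - (p t)^2 * (gs - (N + 1) * g t) <= p t ^ 2 * (Rabs gs + (N + 1) * G)).
      { replace (- (p t)^2 * (gs - (N + 1) * g t)) with ((p t)^2 * (- gs + (N + 1) * g t)) by ring.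
        apply Rmult_le_compat_l; [apply pow2_ge_0|].
        pose proof (Rle_abs (- gs)) as Hx. rewrite Rabs_Ropp in Hx. nra. }
      assert (Hp2 := pow2_ge_0 (p t)).
      assert (Hdw : 0 <= d t * w t ^ 2) by (apply Rmult_le_pos; [lra|apply pow2_ge_0]).
      assert (HM1 : M * b1 * (p t)^2 = (b1 * b1 + Rabs gs + (N + 1) * G + 1) * (p t)^2)
        by now rewrite HMb.
      assert (HM2 : d t * w t ^ 2 <= M * b1 * (d t * w t ^ 2)) by
        (rewrite <- (Rmult_1_l (d t * w t ^ 2)) at 1; apply Rmult_le_compat_r; [easy|rewrite HMb; nra]).
      replace (M * (- b1 * p t ^ 2 - b1 * d t * w t ^ 2 + e t * g t * w t ^ 2 / (N + 2)))
        with (- (M * b1 * (p t)^2) - M * b1 * (d t * w t ^ 2) + M * (e t * g t * w t ^ 2 / (N + 2))) by ring.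
      rewrite HM1. lra. }
    unfold dE. rewrite Rmult_comm.
    replace (- (1 / 2) * phi t ^ 2 * sg t) with ((- (1 / 2) * phi t ^ 2) * sg t) by ring.
    apply Rmult_le_compat_r; [lra|exact HK].
  - generalize All. apply filter_imp. intros t (H0&H1&H2&H3&H4&H5&H6).
    assert (Hp := HP t H1 H6).
    unfold dphi. rewrite Rabs_mult, (Rabs_pos_eq (sg t)), Rmult_comm by lra.
    apply Rmult_le_compat_r; [lra|]. eapply Rle_trans; [|apply Rmax_l].
    unfold Rminus at 1. eapply Rle_trans; [apply Rabs_triang|]. rewrite Rabs_Ropp, !Rabs_mult.
    rewrite (Rabs_pos_eq (w t)), (Rabs_pos_eq (g t)) by lra.
    apply Rplus_le_compat.
    + apply Rmult_le_compat; try apply Rabs_pos; [easy|].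
      unfold Rminus. eapply Rle_trans; [apply Rabs_triang|].
      rewrite Rabs_Ropp, (Rabs_pos_eq (g t)); lra.
    + apply Rmult_le_compat; try lra; [apply Rmult_le_pos; [lra|apply Rabs_pos]|].
      apply Rmult_le_compat; try lra; [apply Rabs_pos|].
      eapply Rle_trans; [apply Rabs_triang|].
      rewrite Rabs_mult, (Rabs_pos_eq N) by lra.
      apply Rplus_le_compat.
      * apply Rmult_le_compat_l; [lra|]. apply Rabs_le. lra.
      * rewrite Rabs_pos_eq by lra. nra.
  - generalize All. apply filter_imp. intros t (H0&H1&H2&H3&H4&H5&H6).
    assert (Hp := HP t H1 H6). assert (Hf := Hphi t H2 H6). unfold E.
    assert (0 <= B * rr t).
    { apply Rmult_le_pos; [|lra]. unfold B. apply Rmult_le_pos; [lra|].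
      apply Rplus_le_le_0_compat; [apply Rmult_le_pos; [apply Rmult_le_pos; [lra|]|left; apply Rinv_0_lt_compat; lra]|].
      - apply Rmult_le_pos; [lra|apply pow2_ge_0].
      - apply Rmult_le_pos; [lra|]. apply Rmult_le_pos; lra. }
    assert (p t * phi t <= P * (W * (Rabs gs + G))).
    { eapply Rle_trans; [apply Rle_abs|]. rewrite Rabs_mult.
      apply Rmult_le_compat; try apply Rabs_pos; easy. }
    assert (0 <= M * (p t ^ 2 / 2)).
    { apply Rmult_le_pos; [lra|]. pose proof (pow2_ge_0 (p t)). lra. }
    assert (0 <= M * (g t * w t ^ 2 / (N + 2))).
    { apply Rmult_le_pos; [lra|]. apply Rmult_le_pos; [|left; apply Rinv_0_lt_compat; lra].
      apply Rmult_le_pos; [lra|apply pow2_ge_0]. }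
    assert (0 <= M * (d t * w t ^ 2 / 2)).
    { apply Rmult_le_pos; [lra|]. apply Rmult_le_pos; [|lra].
      apply Rmult_le_pos; [lra|apply pow2_ge_0]. }
    assert (M * (gs * w t ^ 2 / 2) <= M * (Rabs gs * W ^ 2 / 2)).
    { apply Rmult_le_compat_l; [lra|]. apply Rmult_le_compat_r; [lra|].
      eapply Rle_trans; [apply Rmult_le_compat_r; [apply pow2_ge_0|apply Rle_abs]|].
      apply Rmult_le_compat_l; [lra|]. apply pow_incr. lra. }
    lra.
  - generalize All. apply filter_imp. intros t (H0&H1&H2&H3&H4&H5&H6).
    eapply Rle_trans; [|apply Rmax_r]. now apply Hphi.
Qed.

End Dynamics.

(** * Collapse of [x] *)

(* [Q] behaves like a product of [m] factors [1 + w r] with [w > 0]; [e] is the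
   defect [m - r Q'(r) / Q(r)]. *)
Definition product_like (m : nat) (Q e : R -> R) (A q : R) : Prop :=
  0 < q /\ 0 <= A /\
  (forall r, 0 < r -> 1 <= Q r /\ 0 <= e r <= INR m /\ e r <= A / r /\
     is_derive Q r (Q r * (INR m - e r) / r)) /\
  filterlim (fun r => Q r / r ^ m) (Rbar_locally p_infty) (locally q).

Lemma pow_exp (y : R) (k : nat) : exp y ^ k = exp (INR k * y).
Proof.
  induction k as [|k IH]; [simpl; rewrite Rmult_0_l, exp_0; easy|].
  rewrite S_INR. simpl. rewrite IH, <- exp_plus. f_equal. ring.
Qed.

Section Collapse.

Context (b c cc : R) (n m : nat) (Q e : R -> R) (A q : R) (x x1 rad : R -> R).
Hypothesis c_pos : 0 < c.
Hypothesis cc_pos : 0 < cc.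
Hypothesis n_ge2 : (2 <= n)%nat.
Hypothesis m_bounds : (1 <= m < n)%nat.
Hypothesis Q_prod : product_like m Q e A q.
Hypothesis x_derive : at_left b (fun t => is_derive x t (x1 t)).
Hypothesis x1_derive : at_left b (fun t =>
  is_derive x1 t (c * x t / (x t ^ n * Q (rad t)) - cc * x t)).
Hypothesis rad_derive : at_left b (fun t => is_derive rad t (/ (x t) ^ 2)).
Hypothesis x_pos : at_left b (fun t => 0 < x t).
Hypothesis rad_pos : at_left b (fun t => 0 < rad t).
Hypothesis x_zero : tends b x 0.
Hypothesis rad_infty : forall M, at_left b (fun t => M < rad t).

Let s t := ln (rad t).
Let z t := rad t * x t ^ 2.
Let sg t := / z t.
Let h t := - (x t * x1 t * rad t).
Let d t := cc * z t ^ 2.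
Let g t := c * rad t ^ 2 * x t ^ 4 / (x t ^ n * Q (rad t)).

Lemma z_pos : at_left b (fun t => 0 < z t).
Proof.
  generalize (filter_and _ _ x_pos rad_pos). apply filter_imp. intros t [H1 H2].
  apply Rmult_lt_0_compat; [easy|now apply pow_lt].
Qed.

Lemma sg_pos : at_left b (fun t => 0 < sg t).
Proof. generalize z_pos. apply filter_imp. intros t H. now apply Rinv_0_lt_compat. Qed.

Lemma Q_pos : at_left b (fun t => 0 < Q (rad t)).
Proof.
  generalize rad_pos. apply filter_imp. intros t Ht.
  destruct Q_prod as (_&_&H&_). destruct (H _ Ht) as [H1 _]. lra.
Qed.

Lemma s_derive : at_left b (fun t => is_derive s t (sg t)).
Proof.
  generalize (filter_and _ _ rad_derive (filter_and _ _ x_pos rad_pos)).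
  apply filter_imp. intros t (H1&H2&H3). unfold s, sg, z. auto_derive.
  - repeat split; [eexists; eassumption|lra].
  - rewrite_derive. field. lra.
Qed.

Lemma s_infty (M : R) : at_left b (fun t => M < s t).
Proof.
  generalize (rad_infty (exp M)). apply filter_imp. intros t Ht.
  rewrite <- (ln_exp M). apply ln_increasing; [apply exp_pos|easy].
Qed.

Lemma z_derive : at_left b (fun t => is_derive z t (sg t * (z t * (1 - 2 * h t)))).
Proof.
  generalize (filter_and _ _ rad_derive (filter_and _ _ x_pos (filter_and _ _ rad_pos x_derive))).
  apply filter_imp. intros t (H1&H2&H3&H4). unfold z. auto_derive.
  - repeat split; eexists; eassumption.
  - rewrite_derive.
    unfold sg, z, h. field. lra.
Qed.

Lemma d_derive : at_left b (fun t => is_derive d t (sg t * (2 * d t * (1 - 2 * h t)))).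
Proof.
  generalize z_derive. apply filter_imp. intros t H. unfold d. auto_derive.
  - repeat split; eexists; eassumption.
  - rewrite_derive. ring.
Qed.

Lemma h_derive : at_left b (fun t => is_derive h t (sg t * (h t * (1 - h t) - g t + d t))).
Proof.
  generalize (filter_and _ _ rad_derive (filter_and _ _ x_pos (filter_and _ _ rad_pos
    (filter_and _ _ x_derive (filter_and _ _ x1_derive Q_pos))))).
  apply filter_imp. intros t (H1&H2&H3&H4&H5&H6). unfold h. auto_derive.
  - repeat split; eexists; eassumption.
  - rewrite_derive.
    assert (x t ^ n <> 0) by (apply pow_nonzero; lra).
    unfold sg, z, g, d, z, h. field. repeat split; lra || easy.
Qed.

Lemma g_derive : at_left b (fun t =>
  is_derive g t (sg t * (g t * ((INR n - 4) * h t - (INR m - 2) + e (rad t))))).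
Proof.
  generalize (filter_and _ _ rad_derive (filter_and _ _ x_pos (filter_and _ _ rad_pos
    (filter_and _ _ x_derive Q_pos)))).
  apply filter_imp. intros t (H1&H2&H3&H4&H6).
  destruct Q_prod as (_&_&HQ&_). destruct (HQ _ H3) as (_&_&_&H5).
  destruct n as [|n']; [lia|].
  assert (Hx : x t ^ n' <> 0) by (apply pow_nonzero; lra).
  unfold g. auto_derive.
  - repeat split; try (eexists; eassumption).
    apply Rgt_not_eq. apply Rmult_lt_0_compat; [now apply (pow_lt _ (S n'))|easy].
  - rewrite_derive.
    unfold sg, z, g, h. rewrite S_INR. simpl pred.
    change (x t ^ S n') with (x t * x t ^ n').
    change (match n' with 0%nat => 1 | S _ => INR n' + 1 end) with (INR (S n')).
    rewrite ?S_INR. field. repeat split; lra || easy.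
Qed.

(* If [x1] were nonnegative late, [x1 / x] would stay above [- sqrt cc] up to
   [b], by comparison with the tangent, and [x] could not tend to zero. *)
Lemma x1_neg : at_left b (fun t => x1 t < 0).
Proof.
  set (k := sqrt cc).
  assert (Hk : 0 < k) by now apply sqrt_lt_R0.
  assert (Hkk : k * k = cc) by (apply sqrt_sqrt; lra).
  destruct (proj1 (at_left_iff _ _) (filter_and _ _ x_pos (filter_and _ _ x_derive
    (filter_and _ _ x1_derive Q_pos)))) as [a [Hab Ha]].
  (* During the last stretch of length [PI / 4 / k], a rotation of speed at most [k] turns by less
     than [PI / 4]. *)
  set (a' := Rmax a (b - PI / 4 / k)).
  assert (HPI := PI_RGT_0).
  assert (Hpk : 0 < PI / 4 / k) by (apply Rdiv_lt_0_compat; lra).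
  assert (Ha' : a <= a' < b /\ b - PI / 4 / k <= a').
  { unfold a'. split; [split|]; [apply Rmax_l|apply Rmax_lub_lt; lra|apply Rmax_r]. }
  apply at_left_iff. exists a'. split; [lra|]. intros t Ht.
  apply Rnot_le_lt. intros Hx1.
  (* The phase angle of [(k x, x1)]. The force [- cc x] alone rotates it at speed exactly [- k], and
     the repulsion can only slow this down. From an angle at least 0 it stays above [- PI / 4], that
     is, [x1 > - k x]. *)
  set (th := fun t => atan (x1 t / (k * x t))).
  assert (Hth : forall y, t <= y < b -> - (PI / 4) < th y).
  { intros y Hy.
    assert (H : - th y - k * y <= - th t - k * t).
    { apply (nonincreasing_of_derive a b (fun t => - th t - k * t)
        (fun t => - (k * ((c * x t / (x t ^ n * Q (rad t)) - cc * x t) * x t - x1 t ^ 2)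
                     / (cc * x t ^ 2 + x1 t ^ 2)) - k)); try lra.
      - intros u Hu. destruct (Ha u Hu) as (H1&H2&H3&H4).
        assert (0 < cc * x u ^ 2 + x1 u ^ 2).
        { apply Rplus_lt_le_0_compat; [apply Rmult_lt_0_compat; [easy|now apply pow_lt]|apply pow2_ge_0]. }
        rewrite <- Hkk in *.
        unfold th. auto_derive.
        + repeat split; try (eexists; eassumption). apply Rgt_not_eq. nra.
        + rewrite_derive.
          set (y2 := c * x u / (x u ^ n * Q (rad u)) - k * k * x u).
          field. repeat split; try lra; try nra.
      - intros u Hu. destruct (Ha u Hu) as (H1&H2&H3&H4).
        assert (Hp : 0 < cc * x u ^ 2 + x1 u ^ 2).
        { apply Rplus_lt_le_0_compat; [apply Rmult_lt_0_compat; [easy|now apply pow_lt]|apply pow2_ge_0]. }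
        assert (0 <= c * x u / (x u ^ n * Q (rad u)) * x u).
        { apply Rmult_le_pos; [|lra]. left. apply Rdiv_lt_0_compat; [nra|].
          apply Rmult_lt_0_compat; [now apply pow_lt|easy]. }
        cut (- k <= k * ((c * x u / (x u ^ n * Q (rad u)) - cc * x u) * x u - x1 u ^ 2) /
          (cc * x u ^ 2 + x1 u ^ 2)); [lra|].
        apply Rle_div_r; [easy|].
        replace (- k * (cc * x u ^ 2 + x1 u ^ 2)) with (k * - (cc * x u ^ 2 + x1 u ^ 2)) by ring.
        apply Rmult_le_compat_l; [lra|]. nra. }
    assert (0 <= th t).
    { unfold th. rewrite <- atan_0. destruct (Req_dec (x1 t) 0) as [->|Hne].
      - unfold Rdiv. rewrite Rmult_0_l. lra.
      - left. apply atan_increasing. apply Rdiv_lt_0_compat; [lra|].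
        destruct (Ha t ltac:(lra)) as [H1 _]. nra. }
    assert (k * (y - t) < PI / 4); [|lra].
    assert (PI / 4 = k * (PI / 4 / k)) as -> by (field; lra).
    apply Rmult_lt_compat_l; lra. }
  assert (Hgt : forall y, t < y < b -> - k * x y <= x1 y).
  { intros y Hy. destruct (Ha y ltac:(lra)) as [H1 _].
    specialize (Hth y ltac:(lra)). unfold th in Hth.
    rewrite <- atan_1, <- atan_opp in Hth.
    assert (- (1) < x1 y / (k * x y)).
    { apply Rnot_le_lt. intros [H| H].
      - apply atan_increasing in H. lra.
      - rewrite H in Hth. lra. }
    apply (Rmult_lt_compat_r (k * x y)) in H; [|nra].
    unfold Rdiv in H. rewrite Rmult_assoc, Rinv_l in H by nra. lra. }
  set (u := (t + b) / 2).
  destruct (Ha u ltac:(unfold u; lra)) as [Hxu _].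
  apply (at_left_false b).
  (* Since [x1 >= - k x], the function [x exp (k t)] does not decrease; [b] being finite, this keeps
     [x] above a positive constant. *)
  assert (Hlow : 0 < x u * exp (k * u) * exp (- (k * b))).
  { repeat apply Rmult_lt_0_compat; try apply exp_pos; easy. }
  generalize (filter_and _ _ (tends_lt b x 0 _ x_zero Hlow)
    (at_left_self b u ltac:(unfold u; lra))).
  apply filter_imp. intros y [H1 H2].
  assert (H3 : - (x y * exp (k * y)) <= - (x u * exp (k * u))).
  { apply (nonincreasing_of_derive t b (fun y => - (x y * exp (k * y)))
      (fun y => - ((x1 y + k * x y) * exp (k * y)))); unfold u in *; try lra.
    - intros v Hv. destruct (Ha v ltac:(lra)) as (_&H3&_). auto_derive.
      + repeat split; eexists; eassumption.
      + rewrite_derive. ring.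
    - intros v Hv. specialize (Hgt v Hv).
      assert (0 <= (x1 v + k * x v) * exp (k * v)); [|lra].
      apply Rmult_le_pos; [lra|left; apply exp_pos]. }
  assert (exp (k * y) * exp (- (k * b)) <= 1).
  { rewrite <- exp_plus, <- exp_0. left. apply exp_increasing. nra. }
  destruct (Ha y ltac:(unfold u in *; lra)) as [Hxy _].
  assert (x u * exp (k * u) * exp (- (k * b)) <= x y * exp (k * y) * exp (- (k * b))).
  { apply Rmult_le_compat_r; [left; apply exp_pos|lra]. }
  assert (x y * exp (k * y) * exp (- (k * b)) <= x y); [|lra].
  rewrite Rmult_assoc. nra.
Qed.

Lemma h_pos : at_left b (fun t => 0 < h t).
Proof.
  generalize (filter_and _ _ x1_neg (filter_and _ _ x_pos rad_pos)).
  apply filter_imp. intros t (H1&H2&H3). unfold h.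
  assert (0 < x t * - x1 t * rad t) by (repeat apply Rmult_lt_0_compat; lra). lra.
Qed.

(** In the time [t] the derivative of [z] is [1 - 2 h < 1], so [z - t] is nonincreasing and [z]
    converges. A positive limit would bound the clock speed [1 / z], and [s] could not reach
    infinity at the finite time [b]. *)
Lemma z_zero : tends b z 0.
Proof.
  destruct (proj1 (at_left_iff _ _) (filter_and _ _ z_pos (filter_and _ _ z_derive
    (filter_and _ _ h_pos s_derive)))) as [a [Hab Ha]].
  destruct (nonincreasing_tends a b (- b) (fun t => z t - t) Hab) as [l Hl].
  - apply nonincreasing_of_derive with (fun t => sg t * (z t * (1 - 2 * h t)) - 1); intros t Ht;
      destruct (Ha t Ht) as (H1&H2&H3&_).
    + apply (is_derive_minus (V := R_NormedModule)); [exact H2|apply (is_derive_id (K := R_AbsRing))].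
    + unfold sg. replace (/ z t * (z t * (1 - 2 * h t))) with (1 - 2 * h t) by (field; lra). lra.
  - intros t Ht. destruct (Ha t Ht) as [H1 _]. lra.
  - assert (Hid := tends_id b).
    assert (Hz : tends b z (l + b)).
    { apply (tends_ext b (fun t => (z t - t) + t)); [apply filter_forall; intros; ring|].
      now apply tends_plus. }
    destruct (Rtotal_order (l + b) 0) as [H|[H|H]]; [exfalso|now rewrite H in Hz|exfalso].
    + apply (at_left_false b). generalize (filter_and _ _ z_pos (tends_lt b z _ 0 Hz H)).
      apply filter_imp. intros t Ht. lra.
    + set (y := (l + b) / 2) in *.
      assert (Hy : 0 < y) by (unfold y; lra).
      destruct (proj1 (at_left_iff _ _) (tends_gt b z _ y Hz ltac:(unfold y; lra))) as [a' [Hab' Ha']].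
      set (a2 := Rmax a a'). assert (Ha2 : a <= a2 /\ a' <= a2 /\ a2 < b).
      { unfold a2. split; [apply Rmax_l|split; [apply Rmax_r|apply Rmax_lub_lt; easy]]. }
      set (c0 := (a2 + b) / 2).
      apply (at_left_false b).
      generalize (filter_and _ _ (s_infty (s c0 + / y * (b - c0))) (at_left_self b c0 ltac:(unfold c0; lra))).
      apply filter_imp. intros t [H1 H2].
      assert (H3 : s t - / y * t <= s c0 - / y * c0).
      { apply (nonincreasing_of_derive a2 b (fun t => s t - / y * t) (fun t => sg t - / y * 1));
          unfold c0 in *; try lra.
        - intros u Hu. apply (is_derive_minus (V := R_NormedModule)); [apply Ha; lra|].
          apply is_derive_scal, (is_derive_id (K := R_AbsRing)).
        - intros u Hu. unfold sg. specialize (Ha' u ltac:(lra)).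
          assert (/ z u <= / y); [|lra]. apply Rinv_le_contravar; lra. }
      assert (0 < / y) by now apply Rinv_0_lt_compat. nra.
Qed.

Lemma d_zero : tends b d 0.
Proof.
  apply (tends_ext b (fun t => cc * (z t * z t))); [apply filter_forall; intros; unfold d; ring|].
  replace 0 with (cc * (0 * 0)) by ring. apply tends_scal, tends_mult; apply z_zero.
Qed.

Lemma g_pos : at_left b (fun t => 0 < g t).
Proof.
  generalize (filter_and _ _ x_pos (filter_and _ _ rad_pos Q_pos)).
  apply filter_imp. intros t (H1&H2&H3).
  apply Rdiv_lt_0_compat; repeat apply Rmult_lt_0_compat; try apply pow_lt; lra.
Qed.

(** From [h = 2] on, [h (1 - h) <= -2] outweighs [d < 1], and [- g] only helps. *)
Lemma h_le_2 : at_left b (fun t => h t <= 2).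
Proof.
  apply (trap b s sg s_derive sg_pos s_infty h _ 1 2 ltac:(lra) h_derive).
  generalize (filter_and _ _ sg_pos (filter_and _ _ g_pos (tends_lt b d 0 1 d_zero ltac:(lra)))).
  apply filter_imp. intros t (H1&H2&H3) H4. apply speed_le; [easy|nra].
Qed.

(* [ln g + h] decreases as soon as [g] is large. *)
Lemma g_bounded : exists G, at_left b (fun t => g t <= G).
Proof.
  set (Y := fun t => ln (g t) + h t).
  (* The speed of [ln g] contains no [- g]; adding [h] supplies it. [K] bounds all other terms for
     [0 < h <= 2], and the 2 in [L] is the bound on [h], so that [ln g + h >= L] forces
     [g >= K + 1]. *)
  set (K := 2 * (Rabs (INR n - 4) + INR m + 1) + 5 + INR m).
  set (L := ln (K + 1) + 2).
  assert (HR := Rabs_pos (INR n - 4)).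
  assert (Hm := pos_INR m).
  assert (HK : 0 < K) by (unfold K; nra).
  assert (HY : at_left b (fun t => Y t <= L)).
  { apply (trap b s sg s_derive sg_pos s_infty Y
      (fun t => sg t * ((INR n - 4) * h t - (INR m - 2) + e (rad t) + h t * (1 - h t) - g t + d t)) 1);
      [lra| |].
    - generalize (filter_and _ _ g_pos (filter_and _ _ g_derive h_derive)).
      apply filter_imp. intros t (H1&H2&H3). unfold Y. auto_derive.
      + repeat split; try (eexists; eassumption). easy.
      + rewrite_derive. field. lra.
    - generalize (filter_and _ _ sg_pos (filter_and _ _ g_pos (filter_and _ _ h_pos
        (filter_and _ _ h_le_2 (filter_and _ _ rad_pos (tends_lt b d 0 1 d_zero ltac:(lra))))))).
      apply filter_imp. intros t (H1&H2&H3&H4&H5&H6) HL. apply speed_le; [easy|].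
      assert (K + 1 <= g t).
      { apply Rnot_lt_le. intros Hlt. apply ln_increasing in Hlt; [|easy].
        unfold Y, L in HL. lra. }
      destruct Q_prod as (_&_&HQ&_). destruct (HQ _ H5) as (_&He&_).
      assert ((INR n - 4) * h t <= Rabs (INR n - 4) * 2).
      { eapply Rle_trans; [apply Rle_abs|]. rewrite Rabs_mult, (Rabs_pos_eq (h t)) by lra.
        apply Rmult_le_compat_l; lra. }
      unfold K in *. nra. }
  exists (exp L). generalize (filter_and _ _ HY (filter_and _ _ g_pos h_pos)).
  apply filter_imp. intros t (H1&H2&H3). rewrite <- (exp_ln (g t)) by easy.
  left. apply exp_increasing. unfold Y in H1. lra.
Qed.

Lemma rad_pow_Q : tends b (fun t => rad t ^ m / Q (rad t)) (/ q).
Proof.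
  destruct Q_prod as (Hq&_&_&HQ).
  apply (tends_ext b (fun t => / (Q (rad t) / rad t ^ m))).
  - generalize (filter_and _ _ rad_pos Q_pos). apply filter_imp. intros t [H1 H2].
    field. split; [lra|]. apply pow_nonzero. lra.
  - apply (tends_continuous b (fun t => Q (rad t) / rad t ^ m) Rinv).
    + apply continuous_Rinv. lra.
    + apply tends_filterlim.
      apply (filterlim_comp _ _ _ rad (fun r => Q r / r ^ m) _ (Rbar_locally p_infty)); [|easy].
      intros P [M HM]. unfold filtermap. generalize (rad_infty M). apply filter_imp. intros t. apply HM.
Qed.

Lemma rad_inv_zero : tends b (fun t => / rad t) 0.
Proof. now apply tends_inv_infty. Qed.

(** For [n <= 4] no negative power of [x] remains in [g], so [g] can be read off from [x], [rad] and
    the convergent quotient [rad ^ m / Q]. *)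
Lemma g_zero_n2 : n = 2%nat -> tends b g 0.
Proof.
  intros Hn. assert (Hm : m = 1%nat) by lia.
  apply (tends_ext b (fun t => c * (z t * (rad t ^ m / Q (rad t))))).
  - generalize (filter_and _ _ x_pos Q_pos). apply filter_imp. intros t [H1 H2].
    unfold g, z. rewrite Hm, Hn. field. lra.
  - replace 0 with (c * (0 * / q)) by ring.
    apply tends_scal, tends_mult; [apply z_zero|apply rad_pow_Q].
Qed.

Lemma g_zero_n3 : n = 3%nat -> m = 2%nat -> tends b g 0.
Proof.
  intros Hn Hm.
  apply (tends_ext b (fun t => c * (x t * (rad t ^ m / Q (rad t))))).
  - generalize (filter_and _ _ x_pos Q_pos). apply filter_imp. intros t [H1 H2].
    unfold g. rewrite Hm, Hn. field. lra.
  - replace 0 with (c * (0 * / q)) by ring.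
    apply tends_scal, tends_mult; [apply x_zero|apply rad_pow_Q].
Qed.

(* Here [h / g] would decrease at a speed bounded away from zero. *)
Lemma no_collapse_n3 : n = 3%nat -> m = 1%nat -> False.
Proof.
  intros Hn Hm. destruct Q_prod as (Hq&HA&HQ&_).
  assert (Hiq : 0 < / q) by now apply Rinv_0_lt_compat.
  (* For [n = 3] and [m = 1] the terms containing [h / g] cancel down to [- e h / g <= 0], which
     leaves [- 1 + d / g]. *)
  set (dy := fun t => sg t * (h t / g t * (1 - h t) - 1 + d t / g t
     - h t / g t * ((INR n - 4) * h t - (INR m - 2) + e (rad t)))).
  (* [d -> 0] alone does not control [d / g]; the quotient is [z x] up to a convergent factor. *)
  assert (Hdg : tends b (fun t => d t / g t) 0).
  { apply (tends_ext b (fun t => cc / c * (z t * (x t * / (rad t ^ m / Q (rad t)))))).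
    - generalize (filter_and _ _ x_pos (filter_and _ _ rad_pos Q_pos)).
      apply filter_imp. intros t (H1&H2&H3). unfold d, g, z. rewrite Hm, Hn. field. repeat split; lra.
    - replace 0 with (cc / c * (0 * (0 * / / q))) by ring.
      apply tends_scal, tends_mult; [apply z_zero|]. apply tends_mult; [apply x_zero|].
      apply (tends_continuous b _ Rinv); [apply continuous_Rinv; lra|apply rad_pow_Q]. }
  assert (Hm' := clock_to_minus_infty b s sg s_derive s_infty (fun t => h t / g t) dy (1/2) ltac:(lra)).
  apply (at_left_false b).
  assert (H1 : at_left b (fun t => is_derive (fun t => h t / g t) t (dy t))).
  { generalize (filter_and _ _ h_derive (filter_and _ _ g_derive g_pos)).
    apply filter_imp. intros t (H1&H2&H3). auto_derive.
    - repeat split; try (eexists; eassumption). lra.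
    - rewrite_derive. unfold dy. field. lra. }
  assert (H2 : at_left b (fun t => dy t <= - (1/2) * sg t)).
  { generalize (filter_and _ _ sg_pos (filter_and _ _ h_pos (filter_and _ _ g_pos (filter_and _ _ rad_pos
      (tends_lt b _ 0 (1/2) Hdg ltac:(lra)))))).
    apply filter_imp. intros t (H2&H3&H4&H5&H6). apply speed_le; [easy|].
    destruct (HQ _ H5) as (_&He&_). rewrite Hn, Hm in *. simpl INR in *.
    assert (0 < h t / g t) by now apply Rdiv_lt_0_compat. nra. }
  generalize (filter_and _ _ (Hm' H1 H2 0) (filter_and _ _ h_pos g_pos)).
  apply filter_imp. intros t (H3&H4&H5).
  assert (0 < h t / g t) by now apply Rdiv_lt_0_compat. lra.
Qed.

(** Here [x] cancels and [g] behaves like [(c / q) rad ^ (2 - m)]: unbounded for [m = 1], against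
    [g_bounded], convergent for [m = 2], vanishing for [m = 3]. *)
Lemma g_limit_n4 : n = 4%nat -> exists gi, 0 <= gi /\ tends b g gi.
Proof.
  intros Hn. destruct Q_prod as (Hq&_&_&_).
  assert (Hiq : 0 < / q) by now apply Rinv_0_lt_compat.
  assert (Hm : m = 1%nat \/ m = 2%nat \/ m = 3%nat) by lia.
  destruct Hm as [Hm|[Hm|Hm]].
  - exfalso. destruct g_bounded as [G HG]. apply (at_left_false b).
    assert (HC := tends_gt b _ _ (/ q / 2) rad_pow_Q ltac:(lra)).
    generalize (filter_and _ _ HG (filter_and _ _ HC (filter_and _ _ x_pos (filter_and _ _ Q_pos
      (filter_and _ _ g_pos (rad_infty (G / (c * (/ q / 2))))))))).
    apply filter_imp. intros t (H1&H2&H3&H4&H5&H6).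
    assert (Hg : g t = c * (rad t ^ m / Q (rad t)) * rad t).
    { unfold g. rewrite Hm, Hn. field. lra. }
    assert (Hp : 0 < c * (/ q / 2)) by (apply Rmult_lt_0_compat; lra).
    apply (Rmult_lt_compat_l (c * (/ q / 2))) in H6; [|easy].
    replace (c * (/ q / 2) * (G / (c * (/ q / 2)))) with G in H6 by (field; lra).
    assert (0 < rad t) by nra.
    assert (c * (/ q / 2) * rad t <= c * (rad t ^ m / Q (rad t)) * rad t).
    { apply Rmult_le_compat_r; [lra|]. apply Rmult_le_compat_l; lra. }
    lra.
  - exists (c * / q). split; [apply Rmult_le_pos; lra|].
    apply (tends_ext b (fun t => c * (rad t ^ m / Q (rad t)))).
    + generalize (filter_and _ _ x_pos Q_pos). apply filter_imp. intros t [H1 H2].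
      unfold g. rewrite Hm, Hn. field. lra.
    + apply tends_scal, rad_pow_Q.
  - exists 0. split; [lra|].
    apply (tends_ext b (fun t => c * (/ rad t * (rad t ^ m / Q (rad t))))).
    + generalize (filter_and _ _ rad_pos (filter_and _ _ x_pos Q_pos)). apply filter_imp. intros t (H0&H1&H2).
      unfold g. rewrite Hm, Hn. field. lra.
    + replace 0 with (c * (0 * / q)) by ring.
      apply tends_scal, tends_mult; [apply rad_inv_zero|apply rad_pow_Q].
Qed.

(* [g^2 z^(n-4)] is bounded below, while [z -> 0] and [g] is bounded. *)
Lemma no_collapse_small_m : (5 <= n)%nat -> (2 * m <= n)%nat -> False.
Proof.
  intros Hn Hm. destruct Q_prod as (Hq&_&_&_).
  assert (Hiq : 0 < / q) by now apply Rinv_0_lt_compat.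
  destruct g_bounded as [G HG].
  assert (HC := tends_gt b _ _ (/ q / 2) rad_pow_Q ltac:(lra)).
  set (K := (c * (/ q / 2)) ^ 2).
  assert (HK : 0 < K) by (apply pow_lt, Rmult_lt_0_compat; lra).
  assert (Hz : at_left b (fun t => z t < K / (G ^ 2 + 1))).
  { apply (tends_lt b z 0); [apply z_zero|]. apply Rdiv_lt_0_compat; [easy|].
    pose proof (pow2_ge_0 G). lra. }
  apply (at_left_false b).
  generalize (filter_and _ _ HG (filter_and _ _ HC (filter_and _ _ x_pos (filter_and _ _ Q_pos
      (filter_and _ _ g_pos (filter_and _ _ (rad_infty 1) (filter_and _ _ Hz
       (filter_and _ _ z_pos (tends_lt b z 0 1 z_zero ltac:(lra)))))))))).
  apply filter_imp. intros t (H1&H2&H3&H4&H5&H6&H7&H8&H9).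
  (* The powers of [x] cancel exactly, and [2 m <= n] makes the remaining exponent of [rad]
     nonnegative. *)
  assert (Heq : g t ^ 2 * z t ^ (n - 4) = (c * (rad t ^ m / Q (rad t))) ^ 2 * rad t ^ (n - 2 * m)).
  { assert (Hx : x t ^ n = x t ^ 4 * x t ^ (n - 4)) by (rewrite <- pow_add; f_equal; lia).
    assert (Hr : rad t ^ 4 * rad t ^ (n - 4) = (rad t ^ m) ^ 2 * rad t ^ (n - 2 * m))
      by (rewrite <- pow_mult, <- !pow_add; f_equal; lia).
    assert (Hxn : x t ^ (n - 4) <> 0) by (apply pow_nonzero; lra).
    unfold g, z. rewrite Rpow_mult_distr, <- pow_mult, Hx.
    replace (2 * (n - 4))%nat with ((n - 4) + (n - 4))%nat by lia. rewrite pow_add.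
    transitivity (c ^ 2 / Q (rad t) ^ 2 * (rad t ^ 4 * rad t ^ (n - 4))).
    - field. repeat split; lra || easy.
    - rewrite Hr. field. lra. }
  assert (1 <= rad t ^ (n - 2 * m)) by (apply pow_R1_Rle; lra).
  assert (K <= (c * (rad t ^ m / Q (rad t))) ^ 2).
  { apply pow_incr. split; [apply Rmult_le_pos; lra|]. apply Rmult_le_compat_l; lra. }
  assert (z t ^ (n - 4) <= z t).
  { replace (n - 4)%nat with (S (n - 5)) by lia. simpl.
    assert (z t ^ (n - 5) <= 1 ^ (n - 5)) by (apply pow_incr; lra).
    rewrite pow1 in *. nra. }
  assert (g t ^ 2 <= G ^ 2) by (apply pow_incr; lra).
  assert (K <= g t ^ 2 * z t ^ (n - 4)) by (rewrite Heq; nra).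
  assert (g t ^ 2 * z t ^ (n - 4) <= G ^ 2 * z t).
  { apply Rmult_le_compat; try easy; [apply pow2_ge_0|apply pow_le; lra]. }
  apply (Rmult_lt_compat_l (G ^ 2 + 1)) in H7; [|pose proof (pow2_ge_0 G); lra].
  replace ((G ^ 2 + 1) * (K / (G ^ 2 + 1))) with K in H7
    by (field; pose proof (pow2_ge_0 G); lra).
  lra.
Qed.

(* [w (gs - g) -> 0] keeps [g] out of [(gs/2, 3 gs/4)] when [gs > 0], whence
   [g -> gs] or [w -> 0]. *)
Lemma g_limit_large_m : (5 <= n)%nat -> (n < 2 * m)%nat -> exists gi, 0 <= gi /\ tends b g gi.
Proof.
  intros Hn Hm. destruct Q_prod as (Hq&HA&HQ&_).
  assert (Hiq : 0 < / q) by now apply Rinv_0_lt_compat.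
  destruct g_bounded as [G HG].
  set (N := INR n - 4). set (al := (INR m - 2) / N).
  assert (HN : 0 < N).
  { unfold N. apply le_INR in Hn. simpl in Hn. lra. }
  assert (Hal : 1 / 2 < al).
  { unfold al. apply (Rmult_lt_reg_r N); [exact HN|].
    unfold Rdiv at 2. rewrite Rmult_assoc, Rinv_l, Rmult_1_r by lra. unfold N. apply lt_INR in Hm.
    rewrite mult_INR in Hm. simpl (INR 2) in Hm. lra. }
  assert (HNal : N * al = INR m - 2) by (unfold al; field; lra).
  (* The Emden-Fowler variable [1 / (x rad^al)]: [al] is the exponent for which [g] is [w ^ (n - 4)]
     up to a convergent factor, so that bounds and limits pass between [g] and [w]. *)
  set (w := fun t => exp (- ln (x t) - al * ln (rad t))).
  assert (Hgw : at_left b (fun t => g t = c * (rad t ^ m / Q (rad t)) * w t ^ (n - 4))).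
  { generalize (filter_and _ _ x_pos (filter_and _ _ rad_pos Q_pos)).
    apply filter_imp. intros t (H1&H2&H3).
    assert (Hw : w t ^ (n - 4) * (x t ^ (n - 4) * rad t ^ (m - 2)) = 1).
    { rewrite <- (exp_ln (x t)) at 1 by easy. rewrite <- (exp_ln (rad t)) at 1 by easy.
      unfold w. rewrite !pow_exp, <- !exp_plus, <- exp_0. f_equal.
      rewrite !minus_INR by lia. simpl (INR 4). simpl (INR 2).
      replace (INR n - (1 + 1 + 1 + 1)) with N by (unfold N; ring).
      replace (INR m - (1 + 1)) with (N * al) by (rewrite HNal; ring). ring. }
    assert (Hx : x t ^ n = x t ^ 4 * x t ^ (n - 4)) by (rewrite <- pow_add; f_equal; lia).
    assert (Hr : rad t ^ m = rad t ^ 2 * rad t ^ (m - 2)) by (rewrite <- pow_add; f_equal; lia).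
    assert (Hxn : x t ^ (n - 4) <> 0) by (apply pow_nonzero; lra).
    assert (Hrn : rad t ^ (m - 2) <> 0) by (apply pow_nonzero; lra).
    unfold g. rewrite Hx, Hr.
    replace (w t ^ (n - 4)) with (/ (x t ^ (n - 4) * rad t ^ (m - 2))).
    - field. repeat split; lra || easy.
    - apply (Rmult_eq_reg_r (x t ^ (n - 4) * rad t ^ (m - 2))); [|now apply Rmult_integral_contrapositive].
      rewrite Hw. field. easy. }
  assert (HClo := tends_gt b _ _ (/ q / 2) rad_pow_Q ltac:(lra)).
  assert (HChi := tends_lt b _ _ (2 * / q) rad_pow_Q ltac:(lra)).
  set (C1 := c * (2 * / q)). set (C2 := / (c * (/ q / 2))).
  assert (Hp2 : 0 < c * (/ q / 2)) by (apply Rmult_lt_0_compat; lra).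
  assert (HC1 : 0 < C1) by (apply Rmult_lt_0_compat; lra).
  assert (Hw0 : forall t, 0 < w t) by (intros; apply exp_pos).
  assert (Hsmall : at_left b (fun t => w t <= 1 -> g t <= C1 * w t)).
  { generalize (filter_and _ _ Hgw (filter_and _ _ HClo HChi)). apply filter_imp.
    intros t (H1&H2&H3) H4. rewrite H1. specialize (Hw0 t).
    apply Rmult_le_compat; [apply Rmult_le_pos; lra|apply pow_le; lra|apply Rmult_le_compat_l; lra|].
    replace (n - 4)%nat with (S (n - 5)) by lia. simpl.
    assert (w t ^ (n - 5) <= 1 ^ (n - 5)) by (apply pow_incr; lra).
    rewrite pow1 in *. nra. }
  assert (Hwb : at_left b (fun t => 0 < w t <= 1 + C2 * Rabs G)).
  { generalize (filter_and _ _ Hgw (filter_and _ _ HClo HG)). apply filter_imp.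
    intros t (H1&H2&H3). split; [easy|].
    assert (HC2 : 0 < C2) by now apply Rinv_0_lt_compat.
    assert (HC2G := Rmult_le_pos C2 (Rabs G) ltac:(lra) (Rabs_pos G)).
    destruct (Rle_dec (w t) 1) as [H4|H4]; [lra|].
    assert (w t <= w t ^ (n - 4)).
    { replace (n - 4)%nat with (S (n - 5)) by lia. simpl.
      assert (1 <= w t ^ (n - 5)) by (apply pow_R1_Rle; lra). nra. }
    assert (c * (/ q / 2) * w t <= g t).
    { rewrite H1. apply Rmult_le_compat; try lra. apply Rmult_le_compat_l; lra. }
    assert (w t <= C2 * g t).
    { unfold C2. apply (Rmult_le_reg_l (c * (/ q / 2))); [easy|].
      rewrite <- Rmult_assoc, Rinv_r by lra. lra. }
    pose proof (Rle_abs G). nra. }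
  set (gs := al * (1 - al)).
  assert (Hphi : tends b (fun t => w t * (gs - g t)) 0).
  { apply (emden_fowler_phi b s sg s_derive sg_pos s_infty h g d (fun t => e (rad t)) (fun t => / rad t) w
      N al A G (1 + C2 * Rabs G) 2 HN Hal HA h_derive).
    - generalize g_derive. apply filter_imp. intros t H. evar_last; [exact H|].
      fold N. rewrite <- HNal. ring.
    - apply d_derive.
    - generalize (filter_and _ _ rad_derive (filter_and _ _ rad_pos x_pos)). apply filter_imp.
      intros t (H1&H2&H3). auto_derive.
      + repeat split; try (eexists; eassumption). lra.
      + rewrite_derive. unfold sg, z. field. lra.
    - generalize (filter_and _ _ rad_derive (filter_and _ _ rad_pos (filter_and _ _ x_derive x_pos))).
      apply filter_imp. intros t (H1&H2&H3&H4). unfold w. auto_derive.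
      + repeat split; try (eexists; eassumption); easy.
      + rewrite_derive. unfold sg, z, h, Rminus. field. lra.
    - generalize (filter_and _ _ h_pos h_le_2). now apply filter_imp.
    - generalize (filter_and _ _ g_pos HG). now apply filter_imp.
    - generalize (filter_and _ _ z_pos (tends_lt b d 0 1 d_zero ltac:(lra))).
      apply filter_imp. intros t [H1 H2]. split; [|lra]. unfold d.
      apply Rmult_le_pos; [lra|apply pow2_ge_0].
    - generalize (rad_infty 1). apply filter_imp. intros t H.
      split; [apply Rinv_0_lt_compat; lra|]. rewrite <- Rinv_1.
      apply Rinv_le_contravar; lra.
    - generalize rad_pos. apply filter_imp. intros t H.
      destruct (HQ _ H) as (_&[H1 _]&H2&_). now split.
    - exact Hwb. }
  assert (Hbelow : forall y, 0 < y -> exists w0, 0 < w0 /\ at_left b (fun t => y <= g t -> w0 <= w t)).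
  { intros y Hy. exists (Rmin 1 (y / C1)).
    assert (Hy1 : 0 < y / C1) by now apply Rdiv_lt_0_compat.
    split; [apply Rmin_glb_lt; lra|].
    revert Hsmall. apply filter_imp. intros t H1 H2.
    destruct (Rle_dec (w t) 1) as [H3|H3].
    - eapply Rle_trans; [apply Rmin_r|]. apply Rle_div_l; [easy|]. specialize (H1 H3). lra.
    - eapply Rle_trans; [apply Rmin_l|]. lra. }
  assert (Hto0 : tends b w 0 -> tends b g 0).
  { intros Hw. apply tends_squeeze_0 with (fun t => C1 * w t).
    - generalize (filter_and _ _ Hsmall (filter_and _ _ g_pos (tends_lt b w 0 1 Hw ltac:(lra)))).
      apply filter_imp. intros t (H1&H2&H3). split; [lra|]. apply H1. lra.
    - rewrite <- (Rmult_0_r C1). now apply tends_scal. }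
  (* For [gs <= 0] both parts of [w (gs - g)] have the same sign, so [w g -> 0]; by [Hbelow] this
     forces [g -> 0]. *)
  destruct (Rle_dec gs 0) as [Hgs|Hgs].
  - exists 0. split; [lra|]. intros eps Heps.
    destruct (Hbelow eps Heps) as [w0 [Hw1 Hw2]].
    generalize (filter_and _ _ Hw2 (filter_and _ _ g_pos (Hphi (w0 * eps) ltac:(nra)))).
    apply filter_imp. intros t (H1&H2&H3). rewrite Rminus_0_r, Rabs_pos_eq by lra.
    apply Rnot_le_lt. intros H4. specialize (H1 H4). specialize (Hw0 t).
    apply Rabs_def2 in H3.
    assert (w0 * eps <= w t * g t) by (apply Rmult_le_compat; lra).
    assert (w t * gs <= 0) by nra. lra.
  - destruct (Hbelow (gs / 2) ltac:(lra)) as [w0 [Hw1 Hw2]].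
    destruct (proj1 (at_left_iff _ _) (filter_and _ _ g_derive (filter_and _ _ Hw2
      (Hphi (w0 * (gs / 4)) ltac:(nra))))) as [a [Hab Ha]].
    (* In this strip [w >= w0] and [gs - g >= gs / 4], so [w (gs - g)] could not be small. The strip
       then serves as a wall: the derivative hypothesis of [barrier] holds vacuously. *)
    assert (Hne : forall t, a < t < b -> gs / 2 < g t < gs / 2 + gs / 4 -> False).
    { intros t Ht Hin. destruct (Ha t Ht) as (_&H2&H3%Rabs_def2).
      specialize (H2 ltac:(lra)).
      assert (w0 * (gs / 4) <= w t * (gs - g t)) by (apply Rmult_le_compat; lra). lra. }
    assert (Hdich : at_left b (fun t => g t <= gs / 2) \/ (forall t, a < t < b -> gs / 2 < g t)).
    { destruct (classic (exists t, a < t < b /\ g t <= gs / 2)) as [[t [Ht Hgt]]|H]; [left|right].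
      - apply at_left_iff. exists t. split; [lra|]. intros y Hy.
        apply (barrier a b (gs / 2) (gs / 4) g _ ltac:(lra)
          (fun v Hv => proj1 (Ha v Hv))) with (s := t); try lra.
        intros v Hv Hin. destruct (Hne v Hv Hin).
      - intros t Ht. apply Rnot_le_lt. intros Hle. apply H. now exists t. }
    assert (Hloc := at_left_self b a Hab).
    destruct Hdich as [Hd|Hd].
    (* Below [gs / 2] the factor [gs - g] is at least [gs / 2], so [w] itself must vanish. *)
    + exists 0. split; [lra|]. apply Hto0.
      apply tends_squeeze_0 with (fun t => 2 / gs * (w t * (gs - g t))).
      * revert Hd. apply filter_imp. intros t Hd. specialize (Hw0 t).
        split; [lra|].
        replace (w t) with (2 / gs * (w t * (gs / 2))) at 1 by (field; lra).
        apply Rmult_le_compat_l; [left; apply Rdiv_lt_0_compat; lra|].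
        apply Rmult_le_compat_l; lra.
      * rewrite <- (Rmult_0_r (2 / gs)). now apply tends_scal.
    + exists gs. split; [lra|]. intros eps Heps.
      generalize (filter_and _ _ Hloc (Hphi (w0 * eps) ltac:(nra))).
      apply filter_imp. intros t [Ht H1].
      destruct (Ha t Ht) as (_&H2&_). specialize (H2 ltac:(left; now apply Hd)).
      rewrite Rminus_0_r, Rabs_mult, (Rabs_pos_eq (w t)) in H1 by lra.
      rewrite Rabs_minus_sym. apply (Rmult_lt_reg_l w0); [easy|].
      eapply Rle_lt_trans; [|exact H1]. apply Rmult_le_compat_r; [apply Rabs_pos|easy].
Qed.

Lemma collapse_limit : exists beta, 1/2 <= beta <= 1 /\ tends b (fun t => - (x t * x1 t * rad t)) beta.
Proof.
  assert (Hg : exists gi, 0 <= gi /\ tends b g gi).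
  { destruct (Nat.le_gt_cases 5 n) as [H5|H5].
    - destruct (Nat.le_gt_cases (2 * m) n) as [H|H].
      + exfalso. now apply no_collapse_small_m.
      + now apply g_limit_large_m.
    - assert (Hn : n = 2%nat \/ (n = 3%nat /\ m = 2%nat) \/ (n = 3%nat /\ m = 1%nat) \/ n = 4%nat) by lia.
      destruct Hn as [Hn|[[Hn Hm]|[[Hn Hm]|Hn]]].
      + exists 0. split; [lra|now apply g_zero_n2].
      + exists 0. split; [lra|now apply g_zero_n3].
      + exfalso. now apply no_collapse_n3.
      + now apply g_limit_n4. }
  destruct Hg as [gi [Hgi Hg]].
  exact (logistic_limit b s sg s_derive sg_pos s_infty h g d z gi h_derive z_derive
    h_pos z_pos z_zero Hg d_zero Hgi).
Qed.

End Collapse.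

(** * Continuation by power series *)

Lemma sum_n_m_1_S (f : nat -> R) (n : nat) : sum_n_m f 1 (S n) = sum_n_m f 1 n + f (S n).
Proof. rewrite sum_n_Sm by lia. reflexivity. Qed.

Lemma sum_n_m_1_0 (f : nat -> R) : sum_n_m f 1 0 = 0.
Proof. now rewrite sum_n_m_zero by lia. Qed.

Lemma sum_n_m_bound (f : nat -> R) (n : nat) (C : R) :
  (forall i, (1 <= i <= n)%nat -> Rabs (f i) <= C) -> Rabs (sum_n_m f 1 n) <= INR n * C.
Proof.
  induction n as [|n IH]; intros H.
  - rewrite sum_n_m_1_0, Rabs_R0. simpl. lra.
  - rewrite sum_n_m_1_S, S_INR. eapply Rle_trans; [apply Rabs_triang|].
    specialize (H (S n) ltac:(lia)) as HS.
    assert (Rabs (sum_n_m f 1 n) <= INR n * C) by (apply IH; intros; apply H; lia). lra.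
Qed.

Lemma sum_n_m_1_nonneg (f : nat -> R) (n : nat) : (forall i, 0 <= f i) -> 0 <= sum_n_m f 1 n.
Proof.
  intros H. induction n as [|n IH]; [rewrite sum_n_m_1_0; lra|].
  rewrite sum_n_m_1_S. specialize (H (S n)). lra.
Qed.

(** A Cauchy product has [S N] terms. This factor cancels against the division by [S N] in [next],
    which is what keeps the growth of the coefficients geometric. *)
Lemma PS_mult_bound (u v : nat -> R) (U V K : R) (N : nat) : 0 <= U -> 0 <= K ->
  (forall p, (p <= N)%nat -> Rabs (u p) <= U * K ^ p) ->
  (forall p, (p <= N)%nat -> Rabs (v p) <= V * K ^ p) ->
  Rabs (PS_mult u v N) <= INR (S N) * (U * V * K ^ N).
Proof.
  intros HU HK Hu Hv. unfold PS_mult. eapply Rle_trans; [apply sum_f_R0_triangle|].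
  rewrite Rmult_comm, <- sum_cte. apply sum_Rle. intros p Hp. rewrite Rabs_mult.
  replace (K ^ N) with (K ^ p * K ^ (N - p)) by (rewrite <- pow_add; f_equal; lia).
  replace (U * V * (K ^ p * K ^ (N - p))) with ((U * K ^ p) * (V * K ^ (N - p))) by ring.
  apply Rmult_le_compat; try apply Rabs_pos; [now apply Hu|apply Hv; lia].
Qed.

Section Local_solution.

Context (n : nat) (K cb s0 : R) (a : nat -> R).

(* Index [0] stands for [rho - cb], index [i >= 1] for [lam i]; [table N] lists
   the Taylor coefficients of order at most [N]. *)
Definition next (T : nat -> nat -> R) (N i : nat) : R :=
  let L := fun p => sum_n_m (fun i => T i p) 1 n in
  match i with
  | O => - (PS_mult (T O) L N + cb * L N) / INR (S N)
  | _ => (- PS_mult (T i) (T i) N + K * T O N) / INR (S N)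
  end.

(** Each new coefficient needs all lower orders of several unknowns; extending a whole table makes
    this recursion structural. *)
Fixpoint table (N : nat) : nat -> nat -> R :=
  match N with
  | O => fun i _ => match i with O => s0 | _ => a i end
  | S N' => fun i p => if (p <=? N')%nat then table N' i p else next (table N') N' i
  end.

Definition coef (i p : nat) : R := table p i p.

Lemma table_coef (N i p : nat) : (p <= N)%nat -> table N i p = coef i p.
Proof.
  induction N as [|N IH]; intros Hp.
  - now replace p with 0%nat by lia.
  - destruct (Nat.eq_dec p (S N)) as [->|Hne]; [easy|].
    simpl. rewrite (proj2 (Nat.leb_le p N)) by lia. apply IH. lia.
Qed.

Lemma coef_S (i N : nat) : coef i (S N) = next coef N i.
Proof.
  unfold coef at 1.
  change (table (S N) i (S N)) with
    (if (S N <=? N)%nat then table N i (S N) else next (table N) N i).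
  rewrite (proj2 (Nat.leb_gt (S N) N)) by lia.
  assert (HL : forall p, (p <= N)%nat -> sum_n_m (fun i => table N i p) 1 n = sum_n_m (fun i => coef i p) 1 n).
  { intros p Hp. apply sum_n_m_ext. intros k. now apply table_coef. }
  unfold next. destruct i as [|i].
  - rewrite HL by lia. do 3 f_equal. apply sum_eq. intros p Hp.
    now rewrite HL, table_coef by lia.
  - rewrite table_coef by lia. do 3 f_equal. apply sum_eq. intros p Hp.
    now rewrite !table_coef by lia.
Qed.

(** [B] bounds all initial values; [K1] collects the constants of the two recursions, [n B + |cb| n]
    for the index 0 and [B + |K|] for the others. *)
Let B := 1 + Rabs s0 + sum_n_m (fun i => Rabs (a i)) 1 n.
Let K1 := INR n * B + Rabs cb * INR n + Rabs K + B.

Lemma coef_0_bound (i : nat) : (i <= n)%nat -> Rabs (coef i 0) <= B.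
Proof.
  assert (Hs := fun k => sum_n_m_1_nonneg (fun i => Rabs (a i)) k ltac:(intros; apply Rabs_pos)).
  unfold B. pose proof (Rabs_pos s0). intros Hi. destruct i as [|i].
  - change (coef 0 0) with s0. specialize (Hs n). lra.
  - change (coef (S i) 0) with (a (S i)). assert (Rabs (a (S i)) <= sum_n_m (fun i => Rabs (a i)) 1 n); [|lra].
    induction n as [|k IH]; [lia|]. rewrite sum_n_m_1_S.
    destruct (Nat.eq_dec i k) as [->|Hne]; [specialize (Hs k); lra|].
    assert (Rabs (a (S i)) <= sum_n_m (fun i => Rabs (a i)) 1 k) by (apply IH; lia).
    pose proof (Rabs_pos (a (S k))). lra.
Qed.

Lemma B_pos : 0 < B.
Proof.
  pose proof (sum_n_m_1_nonneg (fun i => Rabs (a i)) n ltac:(intros; apply Rabs_pos)). pose proof (Rabs_pos s0). unfold B. lra.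
Qed.

Lemma K1_pos : 0 < K1.
Proof.
  pose proof B_pos. pose proof (pos_INR n). pose proof (Rabs_pos cb). pose proof (Rabs_pos K).
  unfold K1. nra.
Qed.

(** Strong induction: division by [S N] removes the number of terms of the Cauchy product, and the
    constant that remains beside [B K1 ^ N] is at most [K1]. *)
Lemma coef_bound (p i : nat) : (i <= n)%nat -> Rabs (coef i p) <= B * K1 ^ p.
Proof.
  pose proof B_pos as HB. pose proof K1_pos as HK1.
  pose proof (pos_INR n) as Hn. pose proof (Rabs_pos cb). pose proof (Rabs_pos K).
  revert i. induction p as [p IH] using (well_founded_induction Nat.lt_wf_0). intros i Hi.
  destruct p as [|N].
  - rewrite pow_O, Rmult_1_r. now apply coef_0_bound.
  - assert (HS : 0 < INR (S N)) by (apply lt_0_INR; lia).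
    assert (HS1 : 1 <= INR (S N)) by (apply (le_INR 1); lia).
    assert (HKN : 0 < K1 ^ N) by now apply pow_lt.
    assert (HL : forall p, (p <= N)%nat ->
      Rabs (sum_n_m (fun i => coef i p) 1 n) <= (INR n * B) * K1 ^ p).
    { intros p Hp. rewrite Rmult_assoc. apply sum_n_m_bound. intros k Hk. apply IH; lia. }
    rewrite coef_S. unfold next.
    assert (Hdiv : forall y, Rabs y <= INR (S N) * (B * K1 ^ S N) -> Rabs (y / INR (S N)) <= B * K1 ^ S N).
    { intros y Hy. unfold Rdiv. rewrite Rabs_mult, (Rabs_pos_eq (/ INR (S N))) by (left; now apply Rinv_0_lt_compat).
      apply (Rmult_le_reg_l (INR (S N))); [easy|].
      replace (INR (S N) * (Rabs y * / INR (S N))) with (Rabs y) by (field; lra). easy. }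
    destruct i as [|i]; apply Hdiv.
    + rewrite Rabs_Ropp. eapply Rle_trans; [apply Rabs_triang|].
      assert (H1 := PS_mult_bound (coef 0) (fun p => sum_n_m (fun i => coef i p) 1 n) B (INR n * B) K1 N
        ltac:(lra) ltac:(lra) ltac:(intros; apply IH; lia) HL).
      assert (H2 : Rabs (cb * sum_n_m (fun i => coef i N) 1 n) <= INR (S N) * (B * (Rabs cb * INR n) * K1 ^ N)).
      { rewrite Rabs_mult.
        assert (H2 := Rmult_le_compat_l (Rabs cb) _ _ ltac:(lra) (HL N ltac:(lia))).
        assert (0 <= Rabs cb * (INR n * B * K1 ^ N)) by (repeat apply Rmult_le_pos; lra).
        replace (INR (S N) * (B * (Rabs cb * INR n) * K1 ^ N)) with (INR (S N) * (Rabs cb * (INR n * B * K1 ^ N))) by ring.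
        nra. }
      eapply Rle_trans; [apply Rplus_le_compat; [exact H1|exact H2]|].
      rewrite <- Rmult_plus_distr_l. apply Rmult_le_compat_l; [lra|].
      replace (B * (INR n * B) * K1 ^ N + B * (Rabs cb * INR n) * K1 ^ N) with
        (B * ((INR n * B + Rabs cb * INR n) * K1 ^ N)) by ring.
      apply Rmult_le_compat_l; [lra|]. simpl. apply Rmult_le_compat_r; [lra|]. unfold K1. lra.
    + eapply Rle_trans; [apply Rabs_triang|]. rewrite Rabs_Ropp.
      assert (H1 := PS_mult_bound (coef (S i)) (coef (S i)) B B K1 N
        ltac:(lra) ltac:(lra) ltac:(intros; apply IH; lia) ltac:(intros; apply IH; lia)).
      assert (H2 : Rabs (K * coef 0 N) <= INR (S N) * (B * Rabs K * K1 ^ N)).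
      { rewrite Rabs_mult.
        assert (H2 := Rmult_le_compat_l (Rabs K) _ _ ltac:(lra) (IH N ltac:(lia) 0%nat ltac:(lia))).
        assert (0 <= Rabs K * (B * K1 ^ N)) by (repeat apply Rmult_le_pos; lra).
        replace (INR (S N) * (B * Rabs K * K1 ^ N)) with (INR (S N) * (Rabs K * (B * K1 ^ N))) by ring.
        nra. }
      eapply Rle_trans; [apply Rplus_le_compat; [exact H1|exact H2]|].
      rewrite <- Rmult_plus_distr_l. apply Rmult_le_compat_l; [lra|].
      replace (B * B * K1 ^ N + B * Rabs K * K1 ^ N) with (B * ((B + Rabs K) * K1 ^ N)) by ring.
      apply Rmult_le_compat_l; [lra|]. simpl. apply Rmult_le_compat_r; [lra|]. unfold K1. nra.
Qed.

Lemma CV_radius_geometric (u : nat -> R) (C : R) (t : R) :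
  (forall p, Rabs (u p) <= C * K1 ^ p) -> Rabs t < / K1 -> Rbar_lt (Rabs t) (CV_radius u).
Proof.
  intros Hu Ht. pose proof K1_pos as HK. apply Rbar_lt_le_trans with (/ K1); [exact Ht|].
  apply (proj1 (CV_radius_bounded u)). exists C. intros p.
  rewrite Rabs_mult, (Rabs_pos_eq ((/ K1) ^ p)) by (apply pow_le; left; now apply Rinv_0_lt_compat).
  apply (Rmult_le_reg_r (K1 ^ p)); [now apply pow_lt|].
  rewrite Rmult_assoc, <- Rpow_mult_distr, Rinv_l, pow1, Rmult_1_r by lra. apply Hu.
Qed.

Lemma PSeries_sum (u : nat -> nat -> R) (k : nat) (t : R) :
  (forall i, (1 <= i <= k)%nat -> ex_pseries (u i) t) ->
  ex_pseries (fun p => sum_n_m (fun i => u i p) 1 k) t /\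
  PSeries (fun p => sum_n_m (fun i => u i p) 1 k) t = sum_n_m (fun i => PSeries (u i) t) 1 k.
Proof.
  induction k as [|k IH]; intros H.
  - assert (He : forall p, (fun _ => 0) p = sum_n_m (fun i => u i p) 1 0)
      by (intros p; now rewrite sum_n_m_1_0).
    split.
    + apply (ex_pseries_ext (fun _ => 0)); [exact He|].
      apply CV_radius_inside. now rewrite CV_radius_const_0.
    + rewrite sum_n_m_1_0. rewrite <- (PSeries_ext _ _ t He). apply PSeries_const_0.
  - destruct IH as [IH1 IH2]; [intros; apply H; lia|].
    specialize (H (S k) ltac:(lia)).
    assert (He : forall p, PS_plus (fun p => sum_n_m (fun i => u i p) 1 k) (u (S k)) p =
       sum_n_m (fun i => u i p) 1 (S k)) by (intros p; now rewrite sum_n_m_1_S).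
    split.
    + eapply ex_pseries_ext; [exact He|]. now apply ex_pseries_plus.
    + rewrite <- (PSeries_ext _ _ t He), PSeries_plus, IH2, sum_n_m_1_S by easy. reflexivity.
Qed.

Lemma local_solution : exists r L S, 0 < r /\
  (forall i, (1 <= i <= n)%nat -> L i 0 = a i) /\ S 0 = s0 /\
  (forall t, Rabs t < r ->
    (forall i, (1 <= i <= n)%nat -> is_derive (L i) t (- (L i t) ^ 2 + K * S t)) /\
    is_derive S t (- (S t + cb) * sum_n_m (fun i => L i t) 1 n)).
Proof.
  pose proof K1_pos as HK.
  exists (/ K1), (fun i => PSeries (coef i)), (PSeries (coef 0)).
  split; [now apply Rinv_0_lt_compat|]. split; [|split].
  - intros i Hi. rewrite PSeries_0. destruct i; [lia|easy].
  - apply PSeries_0.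
  - intros t Ht.
    assert (Hcv : forall i, (i <= n)%nat -> Rbar_lt (Rabs t) (CV_radius (coef i))).
    { intros i Hi. apply CV_radius_geometric with B; [|easy]. intros p. now apply coef_bound. }
    assert (HcvL : Rbar_lt (Rabs t) (CV_radius (fun p => sum_n_m (fun i => coef i p) 1 n))).
    { apply CV_radius_geometric with (INR n * B); [|easy]. intros p. rewrite Rmult_assoc.
      apply sum_n_m_bound. intros k Hk. apply coef_bound. lia. }
    assert (HINR : forall p, INR (S p) <> 0) by (intros p; apply not_0_INR; lia).
    split.
    + intros i Hi. evar_last; [apply is_derive_PSeries, Hcv; lia|].
      rewrite (PSeries_ext _ (PS_plus (PS_opp (PS_mult (coef i) (coef i))) (PS_scal K (coef 0)))).
      * rewrite PSeries_plus, PSeries_opp, PSeries_scal, PSeries_mult; try (apply Hcv; lia); [simpl; ring| |].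
        -- apply ex_pseries_opp, ex_pseries_mult; apply Hcv; lia.
        -- apply ex_pseries_scal; [apply Rmult_comm|]. apply CV_radius_inside, Hcv. lia.
      * intros p. unfold PS_derive. rewrite coef_S. destruct i as [|i]; [lia|]. unfold next.
        unfold PS_plus, PS_opp, PS_scal, plus, opp, scal, mult; simpl Hierarchy.plus; cbn -[INR PS_mult].
        unfold mult; cbn -[INR PS_mult]. field. apply HINR.
    + evar_last; [apply is_derive_PSeries, Hcv; lia|].
      rewrite (PSeries_ext _ (PS_opp (PS_plus (PS_mult (coef 0) (fun p => sum_n_m (fun i => coef i p) 1 n))
        (PS_scal cb (fun p => sum_n_m (fun i => coef i p) 1 n))))).
      * rewrite PSeries_opp, PSeries_plus;
          [|apply ex_pseries_mult; [apply Hcv; lia|exact HcvL]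
           |apply ex_pseries_scal; [apply Rmult_comm|exact (CV_radius_inside _ _ HcvL)]].
        rewrite PSeries_scal, PSeries_mult; [|apply Hcv; lia|exact HcvL].
        rewrite (proj2 (PSeries_sum coef n t ltac:(intros; apply CV_radius_inside, Hcv; lia))). ring.
      * intros p. unfold PS_derive. rewrite coef_S. unfold next.
        unfold PS_plus, PS_opp, PS_scal, plus, opp, scal, mult; cbn -[INR PS_mult sum_n_m].
        unfold mult; cbn -[INR PS_mult sum_n_m]. field. apply HINR.
Qed.

End Local_solution.

(** * Gluing a continuation at the end of the interval *)

Definition glue (b : R) (f g : R -> R) (t : R) : R := if Rlt_dec t b then f t else g (t - b).

Lemma glue_lt (b : R) (f g : R -> R) (t : R) : t < b -> glue b f g t = f t.
Proof. intros H. unfold glue. destruct (Rlt_dec t b); [easy|lra]. Qed.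

Lemma glue_ge (b : R) (f g : R -> R) (t : R) : b <= t -> glue b f g t = g (t - b).
Proof. intros H. unfold glue. destruct (Rlt_dec t b); [lra|easy]. Qed.

Lemma glue_derive_lt (b : R) (f g : R -> R) (t d : R) : t < b ->
  is_derive f t d -> is_derive (glue b f g) t d.
Proof.
  intros Ht. apply is_derive_ext_loc. exists (mkposreal (b - t) ltac:(lra)).
  intros y Hy%Rabs_def2. symmetry. apply glue_lt. simpl in Hy.
  unfold minus, plus, opp in Hy; simpl in Hy. lra.
Qed.

Lemma glue_derive_gt (b : R) (f g : R -> R) (t d : R) : b < t ->
  is_derive g (t - b) d -> is_derive (glue b f g) t d.
Proof.
  intros Ht Hg. apply (is_derive_ext_loc (fun y => g (y - b))).
  - exists (mkposreal (t - b) ltac:(lra)).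
    intros y Hy%Rabs_def2. symmetry. apply glue_ge. simpl in Hy.
    unfold minus, plus, opp in Hy; simpl in Hy. lra.
  - evar_last; [apply (is_derive_comp g (fun y => y - b)); [exact Hg|]|].
    + apply (is_derive_minus (V := R_NormedModule)); [apply (is_derive_id (K := R_AbsRing))|apply is_derive_const].
    + unfold scal, minus, plus, opp, one, zero; simpl. unfold mult; simpl. ring.
Qed.

(** The left derivative comes from the limit of [df], by the mean value theorem between [b + h] and
    a point [y] near [b]. Nothing is known about [f] at [b] itself, so [y] stays below [b]. *)
Lemma glue_derive_eq (b : R) (f df g : R -> R) (D : R) :
  at_left b (fun t => is_derive f t (df t)) -> tends b f (g 0) -> tends b df D ->
  is_derive g 0 D -> is_derive (glue b f g) b D.
Proof.
  intros Hf Hfl Hdf Hg. apply is_derive_Reals in Hg. apply is_derive_Reals.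
  intros eps Heps. destruct (Hg eps Heps) as [d Hd].
  destruct (proj1 (at_left_iff _ _) (filter_and _ _ Hf (Hdf (eps / 2) ltac:(lra)))) as [a [Hab Ha]].
  assert (Hmin : 0 < Rmin d (b - a)) by (apply Rmin_glb_lt; [apply cond_pos|lra]).
  exists (mkposreal _ Hmin). intros h Hh0 Hh. simpl in Hh.
  rewrite (glue_ge b f g b), Rminus_diag by lra.
  destruct (Rlt_le_dec h 0) as [Hneg|Hpos].
  - rewrite glue_lt by lra.
    assert (Hah : a < b + h) by (rewrite Rabs_left in Hh by easy; pose proof (Rmin_r d (b - a)); lra).
    assert (Hcl : Rabs (g 0 - f (b + h) - D * - h) <= eps / 2 * - h).
    { apply Rnot_lt_le. intros Hlt.
      (* [y] is taken so late that replacing [f y] by [g 0] and [y] by [b] costs less than [gap]. *)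
      set (gap := Rabs (g 0 - f (b + h) - D * - h) - eps / 2 * - h) in *.
      assert (Hgap : 0 < gap) by (unfold gap; lra).
      assert (HD : 0 < gap / (2 * (Rabs D + 1))) by (apply Rdiv_lt_0_compat; [easy|pose proof (Rabs_pos D); lra]).
      apply (at_left_false b).
      assert (H1 := Hfl (gap / 2) ltac:(lra)).
      assert (H2 := at_left_self b (b + h) ltac:(lra)).
      assert (H3 := at_left_self b (b - gap / (2 * (Rabs D + 1))) ltac:(lra)).
      generalize (filter_and _ _ H1 (filter_and _ _ H2 H3)). clear H1 H2 H3.
      apply filter_imp. intros y (H1&H2&H3).
      destruct (MVT_cor2 f df (b + h) y) as [xi [Hx1 Hx2]]; [lra| |].
      { intros v Hv. apply is_derive_Reals, Ha. lra. }
      destruct (Ha xi ltac:(lra)) as [_ H4].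
      assert (H5 : Rabs (f y - f (b + h) - D * (y - (b + h))) <= eps / 2 * - h).
      { rewrite Hx1, <- Rmult_minus_distr_r, Rabs_mult, (Rabs_pos_eq (y - (b + h))) by lra.
        apply Rmult_le_compat; [apply Rabs_pos|lra|lra|lra]. }
      assert (H6 : Rabs (D * (b - y)) < gap / 2).
      { rewrite Rabs_mult, (Rabs_pos_eq (b - y)) by lra.
        assert (0 <= Rabs D) by apply Rabs_pos.
        assert ((Rabs D + 1) * (b - y) < (Rabs D + 1) * (gap / (2 * (Rabs D + 1))))
          by (apply Rmult_lt_compat_l; lra).
        replace ((Rabs D + 1) * (gap / (2 * (Rabs D + 1)))) with (gap / 2) in H0 by (field; lra).
        nra. }
      assert (H7 : Rabs (g 0 - f (b + h) - D * - h) <= Rabs (f y - g 0) + Rabs (D * (b - y))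
        + Rabs (f y - f (b + h) - D * (y - (b + h)))).
      { replace (g 0 - f (b + h) - D * - h) with
          (- (f y - g 0) + - (D * (b - y)) + (f y - f (b + h) - D * (y - (b + h)))) by ring.
        eapply Rle_trans; [apply Rabs_triang|]. apply Rplus_le_compat_r.
        eapply Rle_trans; [apply Rabs_triang|]. rewrite !Rabs_Ropp. lra. }
      unfold gap in *. lra. }
    replace ((f (b + h) - g 0) / h - D) with ((g 0 - f (b + h) - D * - h) * / - h) by (field; lra).
    rewrite Rabs_mult, (Rabs_pos_eq (/ - h)) by (left; apply Rinv_0_lt_compat; lra).
    apply (Rmult_lt_reg_r (- h)); [lra|]. rewrite Rmult_assoc, Rinv_l by lra. nra.
  - rewrite glue_ge by lra. replace (b + h - b) with (0 + h) by ring.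
    apply Hd; [easy|]. eapply Rlt_le_trans; [exact Hh|apply Rmin_l].
Qed.

Lemma tends_sum (b : R) (f : nat -> R -> R) (l : nat -> R) (n : nat) :
  (forall i, (1 <= i <= n)%nat -> tends b (f i) (l i)) ->
  tends b (fun t => sum_n_m (fun i => f i t) 1 n) (sum_n_m l 1 n).
Proof.
  induction n as [|n IH]; intros H.
  - apply (tends_ext b (fun _ => 0)); [apply filter_forall; intros; now rewrite sum_n_m_1_0|].
    rewrite sum_n_m_1_0. apply tends_const.
  - apply (tends_ext b (fun t => sum_n_m (fun i => f i t) 1 n + f (S n) t));
      [apply filter_forall; intros; now rewrite sum_n_m_1_S|].
    rewrite sum_n_m_1_S. apply tends_plus; [apply IH; intros; apply H; lia|apply H; lia].
Qed.

(** The limits serve as initial values of a power series solution at [tB]; glued to the given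
    solution it solves the system beyond [tB]. At [tB] itself the right sides of the equations
    converge, as [glue_derive_eq] requires. *)
Lemma maximal_no_limit (n : nat) (k cb rho0 tB : R) (lam0 : nat -> R) (lam : nat -> R -> R) (rho : R -> R)
    (l : nat -> R) (rl : R) : 0 < tB ->
  maximal_sol n k cb rho0 lam0 tB lam rho ->
  (forall i, (1 <= i <= n)%nat -> tends tB (lam i) (l i)) -> tends tB rho rl -> False.
Proof.
  intros HtB [[Hl0 [Hr0 [Hlc [Hrc Hode]]]] Hmax] Hl Hr. apply Hmax.
  destruct (local_solution n (k / INR n) cb (rl - cb) l) as (r & L & S & Hr1 & HL0 & HS0 & HLS).
  set (rho' := glue tB rho (fun t => S t + cb)).
  set (lam' := fun i => glue tB (lam i) (L i)).
  assert (Hloc : forall P : R -> Prop, (forall t, 0 < t < tB -> P t) -> at_left tB P).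
  { intros P HP. apply at_left_iff. now exists 0. }
  assert (Hright : forall (f g : R -> R), filterlim f (at_right 0) (locally (f 0)) ->
     filterlim (glue tB f g) (at_right 0) (locally (glue tB f g 0))).
  { intros f g Hf. rewrite glue_lt by easy.
    apply (filterlim_ext_loc f); [|easy]. exists (mkposreal tB HtB). intros y Hy _.
    symmetry. apply glue_lt. apply Rabs_def2 in Hy. simpl in Hy.
    unfold minus, plus, opp in Hy; simpl in Hy. lra. }
  exists (tB + r), lam', rho'. split; [lra|]. split; [|].
  2: { intros t Ht. split; [intros i Hi|]; apply glue_lt; lra. }
  split; [|split; [|split; [|split]]].
  - intros i Hi. unfold lam'. rewrite glue_lt by easy. now apply Hl0.
  - unfold rho'. now rewrite glue_lt by easy.
  - intros i Hi. now apply Hright, Hlc.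
  - now apply Hright.
  - intros t Ht. destruct (Rtotal_order t tB) as [Hlt|[Heq|Hgt]].
    + destruct (Hode t ltac:(lra)) as [H1 H2]. split.
      * intros i Hi. unfold lam', rho'. rewrite !glue_lt by easy.
        apply glue_derive_lt; [easy|now apply H1].
      * replace (lamsum n lam' t) with (lamsum n lam t).
        -- unfold rho'. rewrite glue_lt by easy. now apply glue_derive_lt.
        -- apply sum_n_m_ext. intros i. unfold lam'. now rewrite glue_lt.
    + subst t. destruct (HLS 0 ltac:(now rewrite Rabs_R0)) as [H1 H2]. split.
      * intros i Hi. unfold lam', rho'. rewrite !glue_ge, Rminus_diag by lra.
        apply glue_derive_eq with (fun t => - (lam i t)^2 + k / INR n * (rho t - cb)).
        -- apply Hloc. intros t Ht'. now apply Hode.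
        -- rewrite HL0 by easy. now apply Hl.
        -- rewrite HL0, HS0 by easy. replace (rl - cb + cb) with rl by ring.
           apply tends_plus; [|apply tends_scal, tends_minus; [easy|apply tends_const]].
           apply (tends_continuous tB (lam i) (fun y => - y ^ 2)); [|now apply Hl].
           apply (ex_derive_continuous (fun y => - y ^ 2)). auto_derive. easy.
        -- evar_last; [now apply H1|]. simpl. ring.
      * replace (lamsum n lam' tB) with (sum_n_m (fun i => L i 0) 1 n).
        -- unfold rho'. rewrite glue_ge, Rminus_diag by lra.
           apply glue_derive_eq with (fun t => - rho t * lamsum n lam t).
           ++ apply Hloc. intros t Ht'. now apply Hode.
           ++ rewrite HS0. replace (rl - cb + cb) with rl by ring. easy.
           ++ apply tends_mult.
              ** rewrite HS0. replace (rl - cb + cb) with rl by ring.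
                 apply (tends_ext tB (fun t => 0 - rho t)); [apply filter_forall; intros; ring|].
                 replace (- rl) with (0 - rl) by ring. apply tends_minus; [apply tends_const|easy].
              ** apply tends_sum. intros i Hi. rewrite HL0 by easy. now apply Hl.
           ++ evar_last; [apply (is_derive_plus (V := R_NormedModule)); [exact H2|apply is_derive_const]|].
              unfold plus, zero; simpl. ring.
        -- apply sum_n_m_ext. intros i. unfold lam'. rewrite glue_ge, Rminus_diag by lra. easy.
    + destruct (HLS (t - tB)) as [H1 H2]; [rewrite Rabs_pos_eq; lra|]. split.
      * intros i Hi. unfold lam', rho'. rewrite !glue_ge by lra.
        apply glue_derive_gt; [easy|]. evar_last; [now apply H1|]. simpl. ring.
      * replace (lamsum n lam' t) with (sum_n_m (fun i => L i (t - tB)) 1 n).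
        -- unfold rho'. rewrite glue_ge by lra. apply glue_derive_gt; [easy|].
           evar_last; [apply (is_derive_plus (V := R_NormedModule)); [exact H2|apply is_derive_const]|].
           unfold plus, zero; simpl. ring.
        -- apply sum_n_m_ext. intros i. unfold lam'. rewrite glue_ge by lra. easy.
Qed.

(** * Energy bound and reduction *)

(** Both [f - B t] and [- f - B t] are nonincreasing, and the second bounds the first from below up
    to the finite time [b]. *)
Lemma bounded_derive_tends (b B : R) (f df : R -> R) :
  at_left b (fun t => is_derive f t (df t)) -> at_left b (fun t => Rabs (df t) <= B) ->
  exists l, tends b f l.
Proof.
  intros Hf HB. destruct (proj1 (at_left_iff _ _) (filter_and _ _ Hf HB)) as [a [Hab Ha]].
  assert (Hid := tends_id b).
  assert (HB0 : 0 <= B).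
  { destruct (Ha ((a + b) / 2) ltac:(lra)) as [_ H]. pose proof (Rabs_pos (df ((a + b) / 2))). lra. }
  set (c := (a + b) / 2).
  destruct (nonincreasing_tends c b (f c + B * c - 2 * B * b) (fun t => f t - B * t)) as [l Hl].
  - unfold c; lra.
  - apply nonincreasing_of_derive with (fun t => df t - B * 1); intros t Ht;
      destruct (Ha t ltac:(unfold c in *; lra)) as [H1 H2%Rabs_le_between].
    + apply (is_derive_minus (V := R_NormedModule)); [easy|].
      apply is_derive_scal, (is_derive_id (K := R_AbsRing)).
    + lra.
  - intros t Ht.
    assert (- f t - B * t <= - f c - B * c).
    { apply (nonincreasing_of_derive a b (fun t => - f t - B * t) (fun t => - df t - B * 1));
        try (unfold c in *; lra); intros y Hy; destruct (Ha y Hy) as [H1 H2%Rabs_le_between].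
      - apply (is_derive_minus (V := R_NormedModule)); [now apply (is_derive_opp (V := R_NormedModule))|].
        apply is_derive_scal, (is_derive_id (K := R_AbsRing)).
      - lra. }
    assert (B * t <= B * b) by (apply Rmult_le_compat_l; unfold c in *; lra). lra.
  - exists (l + B * b). apply (tends_ext b (fun t => (f t - B * t) + B * t)).
    + apply filter_forall. intros; ring.
    + now apply tends_plus, tends_scal.
Qed.

(** [Phi] is the potential of the repulsion. For [n = 2] it is [- ln], unbounded below, hence the
    two lower bounds: [- y] serves to bound the kinetic energy, [- y^2] to bound [- Phi / x^2], the
    rate at which the growth of [rad] feeds the energy. *)
Lemma repulsion_potential (n : nat) : (2 <= n)%nat -> exists Phi : R -> R, forall y, 0 < y ->
  is_derive Phi y (- (y / y ^ n)) /\ - y <= Phi y /\ - y ^ 2 <= Phi y.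
Proof.
  intros Hn. destruct (Nat.eq_dec n 2) as [->|Hne].
  - exists (fun y => - ln y). intros y Hy. split.
    + auto_derive; [easy|]. field. lra.
    + assert (ln y <= y - 1).
      { rewrite <- (ln_exp (y - 1)). apply ln_le; [easy|]. pose proof (exp_ineq1_le (y - 1)). lra. }
      pose proof (pow2_ge_0 (y - 1/2)). nra.
  - destruct n as [|[|[|n]]]; try lia.
    exists (fun y => / (INR (S n) * y ^ S n)). intros y Hy.
    assert (HS : 0 < INR (S n)) by (apply lt_0_INR; lia).
    assert (Hyn : 0 < y ^ n) by now apply pow_lt.
    assert (Hp : 0 < INR (S n) * y ^ S n) by (apply Rmult_lt_0_compat; [easy|now apply pow_lt]).
    split.
    + auto_derive; [change (INR (S n) * y ^ S n <> 0); lra|].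
      change (match n with 0%nat => 1 | S _ => INR n + 1 end) with (INR (S n)).
      simpl pred. simpl pow. field. repeat split; lra.
    + assert (0 < / (INR (S n) * y ^ S n)) by now apply Rinv_0_lt_compat.
      pose proof (pow2_ge_0 y). lra.
Qed.

(* The energy [x1^2/2 + cc x^2/2 + c Phi(x)/Q(rad)] grows at a bounded rate. *)
Lemma energy_bound (b c cc r0 : R) (n m : nat) (Q e : R -> R) (A q : R) (x x1 rad : R -> R) :
  0 < c -> 0 < cc -> 0 < r0 -> (2 <= n)%nat -> product_like m Q e A q ->
  at_left b (fun t => is_derive x t (x1 t)) ->
  at_left b (fun t => is_derive x1 t (c * x t / (x t ^ n * Q (rad t)) - cc * x t)) ->
  at_left b (fun t => is_derive rad t (/ (x t) ^ 2)) ->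
  at_left b (fun t => 0 < x t) -> at_left b (fun t => r0 <= rad t) ->
  exists B, at_left b (fun t => x t <= B /\ Rabs (x1 t) <= B).
Proof.
  intros Hc Hcc Hr0 Hn (_&_&HQ&_) Hx Hx1 Hrad Hxp Hrp.
  destruct (repulsion_potential n Hn) as [Phi HPhi].
  destruct (proj1 (at_left_iff _ _) (filter_and _ _ Hx (filter_and _ _ Hx1 (filter_and _ _ Hrad
    (filter_and _ _ Hxp Hrp))))) as [a [Hab Ha]].
  set (F := fun t => x1 t ^ 2 / 2 + cc * x t ^ 2 / 2 + c * Phi (x t) / Q (rad t)).
  (* The energy changes only through [Q (rad t)], at the rate [(- Phi / x^2) c (m - e) / (rad Q)],
     which is at most [D] because [rad >= r0] and [Q >= 1]. *)
  set (D := c * INR m / r0).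
  set (a0 := (a + b) / 2).
  assert (HD0 : 0 <= D).
  { unfold D. apply Rmult_le_pos; [|left; now apply Rinv_0_lt_compat].
    apply Rmult_le_pos; [lra|apply pos_INR]. }
  assert (HF : forall t, a0 < t < b -> F t <= F a0 + D * (b - a0)).
  { intros t Ht.
    assert (H : F t - D * t <= F a0 - D * a0).
    { apply (nonincreasing_of_derive a b (fun t => F t - D * t)
       (fun t => - (c * Phi (x t) * (INR m - e (rad t)) / (rad t * Q (rad t) * x t ^ 2)) - D * 1));
       try (unfold a0 in *; lra); intros y Hy; destruct (Ha y Hy) as (H1&H2&H3&H4&H5);
       destruct (HQ (rad y) ltac:(lra)) as (H6&H7&_&H8); destruct (HPhi (x y) H4) as (H9&H10&H11).
      - apply (is_derive_minus (V := R_NormedModule)); [|apply is_derive_scal, (is_derive_id (K := R_AbsRing))].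
        assert (x y ^ n <> 0) by (apply pow_nonzero; lra).
        unfold F. auto_derive.
        + repeat split; try (eexists; eassumption). lra.
        + rewrite_derive. field. repeat split; lra || easy.
      - assert (Hq1 : 0 < Q (rad y)) by lra.
        assert (Hx2 : 0 < x y ^ 2) by now apply pow_lt.
        assert (- Phi (x y) / x y ^ 2 <= 1) by (apply Rle_div_l; lra).
        assert (Hw : 0 <= c * (INR m - e (rad y)) / (rad y * Q (rad y)) <= D).
        { assert (Hrq : r0 <= rad y * Q (rad y)) by nra.
          split.
          - apply Rmult_le_pos; [apply Rmult_le_pos; lra|left; apply Rinv_0_lt_compat; lra].
          - unfold D, Rdiv. apply Rmult_le_compat.
            + apply Rmult_le_pos; lra.
            + left; apply Rinv_0_lt_compat; lra.
            + apply Rmult_le_compat_l; lra.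
            + apply Rinv_le_contravar; lra. }
        replace (- (c * Phi (x y) * (INR m - e (rad y)) / (rad y * Q (rad y) * x y ^ 2))) with
          ((c * (INR m - e (rad y)) / (rad y * Q (rad y))) * (- Phi (x y) / x y ^ 2))
          by (field; repeat split; lra).
        nra. }
    assert (D * t <= D * b) by (apply Rmult_le_compat_l; lra). lra. }
  set (K := F a0 + D * (b - a0)) in *.
  assert (HK : forall t, a0 < t < b -> x1 t ^ 2 / 2 + cc * x t ^ 2 / 2 <= K + c * x t).
  { intros t Ht. specialize (HF t Ht). destruct (Ha t ltac:(unfold a0 in *; lra)) as (_&_&_&H4&H5).
    destruct (HQ (rad t) ltac:(lra)) as (H6&_). destruct (HPhi (x t) H4) as (_&H10&_).
    assert (- (c * x t) <= c * Phi (x t) / Q (rad t)).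
    { apply Rle_div_r; [lra|].
      assert (c * x t * 1 <= c * x t * Q (rad t)) by (apply Rmult_le_compat_l; nra). nra. }
    unfold F in HF. lra. }
  (* Beyond [B1] the quadratic [cc x^2 / 2] exceeds [K + c x]. *)
  set (B1 := 1 + 2 * (Rabs K + c) / cc).
  assert (HcB : cc * B1 = cc + 2 * (Rabs K + c)) by (unfold B1; field; lra).
  set (B2 := 1 + Rabs (2 * (K + c * B1))).
  exists (Rmax B1 B2). apply at_left_iff. exists a0. split; [unfold a0; lra|].
  intros t Ht. specialize (HK t Ht). destruct (Ha t ltac:(unfold a0 in *; lra)) as (_&_&_&H4&_).
  assert (Hxb : x t <= B1).
  { apply Rnot_lt_le. intros Hlt. pose proof (Rle_abs K). pose proof (Rabs_pos K).
    assert (1 <= B1).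
    { unfold B1. assert (0 <= 2 * (Rabs K + c) / cc); [|lra].
      apply Rmult_le_pos; [lra|left; now apply Rinv_0_lt_compat]. }
    assert (cc * B1 < cc * x t) by (apply Rmult_lt_compat_l; lra).
    assert (Rabs K < x t * (cc * x t / 2 - c)) by nra.
    pose proof (pow2_ge_0 (x1 t)). nra. }
  split; [eapply Rle_trans; [exact Hxb|apply Rmax_l]|].
  eapply Rle_trans; [|apply Rmax_r]. unfold B2.
  set (S := 2 * (K + c * B1)) in *.
  assert (Hsq : Rabs (x1 t) ^ 2 <= Rabs S).
  { rewrite pow2_abs. eapply Rle_trans; [|apply Rle_abs]. unfold S.
    assert (c * x t <= c * B1) by (apply Rmult_le_compat_l; lra).
    assert (0 <= cc * x t ^ 2) by (apply Rmult_le_pos; [lra|apply pow2_ge_0]). lra. }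
  pose proof (Rabs_pos (x1 t)). apply Rnot_lt_le. intros Hlt. pose proof (Rabs_pos S). nra.
Qed.

(** * The product [Q] of affine factors and its growth *)

Fixpoint Qprod (W : nat -> R) (n : nat) (r : R) : R :=
  match n with O => 1 | S p => Qprod W p r * (1 + W (S p) * r) end.

(** The new factor has degree one up to the defect [1 - w r / (1 + w r) = 1 / (1 + w r)], which is
    at most 1 and at most [1 / (w r)]. *)
Lemma product_like_mult (m : nat) (Q e : R -> R) (A q w : R) : 0 < w -> product_like m Q e A q ->
  product_like (S m) (fun r => Q r * (1 + w * r)) (fun r => e r + / (1 + w * r)) (A + / w) (q * w).
Proof.
  intros Hw (Hq&HA&HQ&HL). assert (Hiw : 0 < / w) by now apply Rinv_0_lt_compat.
  split; [now apply Rmult_lt_0_compat|]. split; [lra|]. split.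
  - intros r Hr. destruct (HQ r Hr) as (H1&H2&H3&H4).
    assert (Hwr : 0 < w * r) by now apply Rmult_lt_0_compat.
    assert (H5 : 0 < / (1 + w * r)) by (apply Rinv_0_lt_compat; lra).
    assert (H6 : / (1 + w * r) <= 1) by (rewrite <- Rinv_1; apply Rinv_le_contravar; lra).
    split; [nra|]. split; [rewrite S_INR; lra|]. split.
    + unfold Rdiv. rewrite Rmult_plus_distr_r. apply Rplus_le_compat; [easy|].
      rewrite <- Rinv_mult. apply Rinv_le_contravar; lra.
    + auto_derive; [repeat split; eexists; eassumption|].
      rewrite_derive. rewrite S_INR. field. split; lra.
  - apply (filterlim_ext_loc (fun r => Q r / r ^ m * (/ r + w))).
    + exists 0. intros r Hr. simpl pow. assert (r ^ m <> 0) by (apply pow_nonzero; lra).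
      field. split; [easy|lra].
    + eapply filterlim_comp_2; [exact HL| |apply (filterlim_mult (K := R_AbsRing))].
      replace w with (0 + w) at 1 by ring.
      eapply filterlim_comp_2; [|apply filterlim_const|apply (filterlim_plus (V := R_NormedModule))].
      apply (filterlim_Rbar_inv p_infty). easy.
Qed.

(** The first [J] factors are identically 1, so only the [k] positive slopes count in the degree. *)
Lemma Qprod_product_like (W : nat -> R) (J k : nat) :
  (forall i, (1 <= i <= J)%nat -> W i = 0) -> (forall i, (J < i <= J + k)%nat -> 0 < W i) ->
  exists e A q, product_like k (Qprod W (J + k)) e A q.
Proof.
  intros H0 Hp. induction k as [|k IH].
  - rewrite Nat.add_0_r.
    assert (HQ : forall r, Qprod W J r = 1).
    { intros r. clear Hp. induction J as [|p IH]; [easy|]. simpl.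
      rewrite H0, IH by (intros; try apply H0; lia). ring. }
    exists (fun _ => 0), 0, 1. split; [lra|]. split; [lra|]. split.
    + intros r Hr. rewrite HQ. split; [lra|]. split; [simpl; lra|]. split; [lra|].
      apply (is_derive_ext (fun _ => 1)); [intros; now rewrite HQ|].
      evar_last; [apply is_derive_const|]. unfold zero; simpl. field. lra.
    + apply (filterlim_ext (fun _ => 1)); [intros r; rewrite HQ; simpl; lra|].
      apply filterlim_const.
  - destruct IH as (e&A&q&H); [intros; apply Hp; lia|].
    rewrite Nat.add_succ_r. exists (fun r => e r + / (1 + W (S (J + k)) * r)), (A + / W (S (J + k))), (q * W (S (J + k))).
    apply product_like_mult; [apply Hp; lia|easy].
Qed.

(** The equations hold on the open interval only, so the initial data enter through limits from the
    right at 0. *)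
Lemma constant_of_derive_0 (T v : R) (f : R -> R) :
  (forall t, 0 < t < T -> is_derive f t 0) -> filterlim f (at_right 0) (locally v) ->
  forall t, 0 < t < T -> f t = v.
Proof.
  intros Hf Hv t Ht.
  assert (Hc : forall y, 0 < y < T -> f y = f t).
  { assert (Hle : forall y z, 0 < y <= z -> z < T -> f y = f z).
    { intros y z Hy Hz. apply Rle_antisym.
      - cut (- f z <= - f y); [lra|].
        apply (nonincreasing_of_derive 0 T (fun t => - f t) (fun _ => - 0)); try easy; [|intros; lra].
        intros c Hc. apply (is_derive_opp (V := R_NormedModule)). now apply Hf.
      - apply (nonincreasing_of_derive 0 T f (fun _ => 0)); try easy. }
    intros y Hy. destruct (Rle_dec y t); [|symmetry]; apply Hle; lra. }
  apply (filterlim_locally_unique (F := at_right 0) f); [|easy].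
  apply (filterlim_ext_loc (fun _ => f t)); [|apply filterlim_const].
  exists (mkposreal T ltac:(lra)). intros y Hy%Rabs_def2 Hy0. symmetry. apply Hc.
  simpl in Hy. unfold minus, plus, opp in Hy; simpl in Hy. lra.
Qed.

(** To the left of 0 nothing is known about [f], while differentiating an integral asks for
    continuity around each point; [C0_extension_left] supplies a continuous function with the same
    integrals for [t >= 0]. *)
Lemma exp_RInt_facts (T : R) (f : R -> R) : 0 < T ->
  (forall t, 0 < t < T -> continuous f t) -> filterlim f (at_right 0) (locally (f 0)) ->
  (forall t, 0 < t < T -> is_derive (fun t => exp (RInt f 0 t)) t (f t * exp (RInt f 0 t))) /\
  filterlim (fun t => exp (RInt f 0 t)) (at_right 0) (locally 1).
Proof.
  intros HT Hf H0.
  destruct (C0_extension_left f (f 0) 0 T HT Hf H0) as (g&Hg1&Hg2&Hg3).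
  assert (Heq : forall t, 0 <= t -> RInt f 0 t = RInt g 0 t).
  { intros t Ht. apply RInt_ext. intros y Hy. rewrite Rmin_left in Hy by easy.
    symmetry. apply Hg2. lra. }
  assert (Hd : forall t, 0 <= t < T -> is_derive (RInt g 0) t (g t)).
  { intros t Ht. apply is_derive_RInt with (a := 0); [|now apply Hg1].
    exists (mkposreal (T - t) ltac:(lra)). intros y Hy%Rabs_def2.
    simpl in Hy. unfold minus, plus, opp in Hy; simpl in Hy.
    apply (RInt_correct (V := R_CompleteNormedModule)), ex_RInt_continuous. intros z Hz. apply Hg1.
    eapply Rle_lt_trans; [apply Hz|]. apply Rmax_lub_lt; lra. }
  split.
  - intros t Ht. rewrite <- (Hg2 t) by easy. rewrite (Heq t) by lra.
    apply (is_derive_ext_loc (fun t => exp (RInt g 0 t))).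
    + exists (mkposreal t ltac:(lra)). intros y Hy%Rabs_def2.
      simpl in Hy. unfold minus, plus, opp in Hy; simpl in Hy. rewrite Heq; [easy|lra].
    + apply (is_derive_comp exp (RInt g 0)); [apply is_derive_exp|]. apply Hd. lra.
  - apply (filterlim_ext_loc (fun t => exp (RInt g 0 t))).
    + exists (mkposreal T HT). intros y _ Hy. rewrite Heq; [easy|lra].
    + apply (filterlim_filter_le_1 (F := locally 0) (G := at_right 0)).
      * apply filter_le_within.
      * assert (Hc : continuous (fun t => exp (RInt g 0 t)) 0).
        { apply (ex_derive_continuous (fun t => exp (RInt g 0 t))). eexists.
          apply (is_derive_comp exp (RInt g 0)); [apply is_derive_exp|]. apply Hd. lra. }
        unfold continuous in Hc. rewrite RInt_point in Hc. unfold zero in Hc; simpl in Hc.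
        now rewrite exp_0 in Hc.
Qed.

(** * Wronskians and the reduction to one unknown *)

Section Reduction.

Context (n j : nat) (k cb rho0 T : R) (lam0 : nat -> R) (lam : nat -> R -> R) (rho : R -> R).
Hypothesis T_pos : 0 < T.
Hypothesis n_pos : (1 <= n)%nat.
Hypothesis j_bounds : (1 <= j <= n)%nat.
Hypothesis lam0_lt : lam0 1%nat < lam0 j.
Hypothesis sol : is_sol n k cb rho0 lam0 T lam rho.

Let W (i : nat) : R := lam0 i - lam0 1%nat.
(** Solving [u_j = u_1 (1 + W_j r)] for [r] yields the integral of [1 / u_1^2] without introducing
    another integral. *)
Let rad (t : R) : R := (u lam j t / u lam 1 t - 1) / W j.

Lemma W_j_pos : 0 < W j.
Proof. unfold W. lra. Qed.

Lemma u_pos (i : nat) (t : R) : 0 < u lam i t.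
Proof. apply exp_pos. Qed.

Lemma u_facts (i : nat) : (1 <= i <= n)%nat ->
  (forall t, 0 < t < T -> is_derive (u lam i) t (lam i t * u lam i t)) /\
  filterlim (u lam i) (at_right 0) (locally 1).
Proof.
  intros Hi. destruct sol as (_&_&Hc&_&Hode).
  apply exp_RInt_facts; [easy| |now apply Hc].
  intros t Ht. apply (ex_derive_continuous (lam i)). exists (- lam i t ^ 2 + k / INR n * (rho t - cb)).
  exact (proj1 (Hode t Ht) i Hi).
Qed.

Lemma right_mult (f g : R -> R) (l m : R) :
  filterlim f (at_right 0) (locally l) -> filterlim g (at_right 0) (locally m) ->
  filterlim (fun t => f t * g t) (at_right 0) (locally (l * m)).
Proof.
  intros Hf Hg. eapply filterlim_comp_2; [exact Hf|exact Hg|].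
  exact (filterlim_mult (K := R_AbsRing) l m).
Qed.

Lemma right_minus (f g : R -> R) (l m : R) :
  filterlim f (at_right 0) (locally l) -> filterlim g (at_right 0) (locally m) ->
  filterlim (fun t => f t - g t) (at_right 0) (locally (l - m)).
Proof.
  intros Hf Hg. apply (filterlim_ext (fun t => f t + -1 * g t)); [intros; ring|].
  eapply filterlim_comp_2; [exact Hf|apply right_mult; [apply filterlim_const|exact Hg]|].
  replace (l - m) with (l + -1 * m) by ring.
  exact (filterlim_plus (V := R_NormedModule) l (-1 * m)).
Qed.

(** In [lam i - lam 1] the common term [(k / n) (rho - cb)] cancels, so the difference decays at the
    rate [lam i + lam 1], at which [u_1 u_i] grows. *)
Lemma wronskian (i : nat) (t : R) : (1 <= i <= n)%nat -> 0 < t < T ->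
  u lam 1 t * u lam i t * (lam i t - lam 1%nat t) = W i.
Proof.
  intros Hi. revert t.
  destruct (u_facts i Hi) as [Hd Hr]. destruct (u_facts 1 ltac:(lia)) as [Hd1 Hr1].
  destruct sol as (Hl0&_&Hc&_&Hode).
  apply (constant_of_derive_0 T _ (fun t => u lam 1 t * u lam i t * (lam i t - lam 1%nat t))).
  - intros t Ht. specialize (Hd t Ht). specialize (Hd1 t Ht).
    destruct (Hode t Ht) as [Ho _].
    assert (Hoi := Ho i Hi). assert (Ho1 := Ho 1%nat ltac:(lia)).
    revert Hd Hd1 Hoi Ho1. generalize (u lam 1) (u lam i) (lam 1%nat) (lam i).
    intros v1 vi l1 li Hd Hd1 Hoi Ho1. auto_derive; [repeat split; eexists; eassumption|]. rewrite_derive. ring.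
  - replace (W i) with (1 * 1 * (lam i 0 - lam 1%nat 0)) by (unfold W; rewrite !Hl0 by lia; ring).
    apply right_mult; [now apply right_mult|]. apply right_minus; apply Hc; lia.
Qed.

Lemma ratio_derive (i : nat) (t : R) : (1 <= i <= n)%nat -> 0 < t < T ->
  is_derive (fun t => u lam i t / u lam 1 t - 1) t (W i / u lam 1 t ^ 2).
Proof.
  intros Hi Ht. assert (Hd := proj1 (u_facts i Hi) t Ht).
  assert (Hd1 := proj1 (u_facts 1 ltac:(lia)) t Ht).
  assert (Hp := u_pos 1 t). rewrite <- (wronskian i t Hi Ht).
  revert Hd Hd1 Hp. generalize (u lam 1) (u lam i) (lam 1%nat) (lam i).
  intros v1 vi l1 li Hd Hd1 Hp. auto_derive; [repeat split; try (eexists; eassumption); lra|]. rewrite_derive. field. lra.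
Qed.

Lemma ratio_right (i : nat) : (1 <= i <= n)%nat ->
  filterlim (fun t => u lam i t / u lam 1 t - 1) (at_right 0) (locally 0).
Proof.
  intros Hi. replace 0 with (1 * / 1 - 1) at 2 by field.
  apply right_minus; [|apply filterlim_const]. apply right_mult; [now apply u_facts|].
  eapply filterlim_comp; [apply (u_facts 1); lia|]. apply continuous_Rinv. lra.
Qed.

Lemma rad_derive (t : R) : 0 < t < T -> is_derive rad t (/ u lam 1 t ^ 2).
Proof.
  intros Ht. pose proof W_j_pos. pose proof (u_pos 1 t).
  apply (is_derive_ext (fun t => / W j * (u lam j t / u lam 1 t - 1))).
  { intros y. apply Rmult_comm. }
  evar_last; [apply is_derive_scal, ratio_derive; easy|]. field. lra.
Qed.

(** Each [u_i / u_1 - 1] starts from 0 with derivative [W_i / u_1^2], so those for [i] and [j] are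
    in the ratio of [W_i] to [W_j]. *)
Lemma u_ratio (i : nat) (t : R) : (1 <= i <= n)%nat -> 0 < t < T ->
  u lam i t = u lam 1 t * (1 + W i * rad t).
Proof.
  intros Hi Ht. pose proof (u_pos 1 t).
  assert (H0 : (u lam i t / u lam 1 t - 1) - W i / W j * (u lam j t / u lam 1 t - 1) = 0).
  { clear H. revert t Ht.
    apply (constant_of_derive_0 T 0
      (fun t => (u lam i t / u lam 1 t - 1) - W i / W j * (u lam j t / u lam 1 t - 1))).
    - intros t Ht. evar_last.
      + apply (is_derive_minus (V := R_NormedModule)); [now apply ratio_derive|].
        now apply is_derive_scal, ratio_derive.
      + pose proof W_j_pos. pose proof (u_pos 1 t). unfold minus, plus, opp; simpl. field. lra.
    - replace 0 with (0 - W i / W j * 0) at 2 by ring.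
      apply right_minus; [now apply ratio_right|]. apply right_mult; [apply filterlim_const|now apply ratio_right]. }
  pose proof W_j_pos. unfold rad.
  replace (W i * ((u lam j t / u lam 1 t - 1) / W j)) with (W i / W j * (u lam j t / u lam 1 t - 1))
    by (field; lra).
  replace (W i / W j * (u lam j t / u lam 1 t - 1)) with (u lam i t / u lam 1 t - 1) by lra.
  field. lra.
Qed.

Lemma rad_increasing (s t : R) : 0 < s < t -> t < T -> rad s < rad t.
Proof.
  intros Hs Ht. destruct (MVT_cor2 rad (fun t => / u lam 1 t ^ 2) s t) as [c [H1 H2]]; [lra| |].
  - intros c Hc. apply is_derive_Reals, rad_derive. lra.
  - assert (0 < / u lam 1 c ^ 2) by (apply Rinv_0_lt_compat, pow_lt, u_pos). nra.
Qed.

Lemma rad_pos (t : R) : 0 < t < T -> 0 < rad t.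
Proof.
  assert (Hr : filterlim rad (at_right 0) (locally 0)).
  { replace 0 with (0 * / W j) at 2 by ring. apply right_mult; [now apply ratio_right|apply filterlim_const]. }
  intros Ht. apply Rle_lt_trans with (rad (t / 2)); [|apply rad_increasing; lra].
  apply (filterlim_le (F := at_right 0) rad (fun _ => rad (t / 2)) 0 (rad (t / 2)));
    [|exact Hr|apply filterlim_const].
  exists (mkposreal (t / 2) ltac:(lra)). intros y Hy%Rabs_def2 Hy0.
  simpl in Hy. unfold minus, plus, opp in Hy; simpl in Hy.
  left. apply rad_increasing; lra.
Qed.

(** The product of all [u_i], built up as [P], grows at the rate [lamsum], at which [rho] decays. *)
Lemma rho_Qprod (t : R) : 0 < t < T -> rho t * (u lam 1 t ^ n * Qprod W n (rad t)) = rho0.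
Proof.
  intros Ht.
  set (P := fix P (p : nat) (t : R) : R := match p with O => 1 | S q => P q t * u lam (S q) t end).
  assert (HP : forall p, (p <= n)%nat ->
    (forall t, 0 < t < T -> is_derive (P p) t (P p t * sum_n_m (fun i => lam i t) 1 p) /\
       P p t = u lam 1 t ^ p * Qprod W p (rad t)) /\
    filterlim (P p) (at_right 0) (locally 1)).
  { induction p as [|p IH]; intros Hp.
    - split; [|apply (filterlim_ext (fun _ => 1)); [easy|apply filterlim_const]].
      intros y Hy. split; [|simpl; ring].
      rewrite sum_n_m_1_0, Rmult_0_r.
      apply (is_derive_ext (fun _ => 1)); [easy|]. exact (is_derive_const (K := R_AbsRing) (V := R_NormedModule) 1 y).
    - destruct IH as [IH1 IH2]; [lia|]. destruct (u_facts (S p) ltac:(lia)) as [Hd Hr]. split.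
      + intros y Hy. destruct (IH1 y Hy) as [H1 H2]. specialize (Hd y Hy). split.
        * change (is_derive (fun t => P p t * u lam (S p) t) y
            (P p y * u lam (S p) y * sum_n_m (fun i => lam i y) 1 (S p))).
          rewrite sum_n_m_1_S. auto_derive; [repeat split; eexists; eassumption|]. rewrite_derive. ring.
        * change (P (S p) y) with (P p y * u lam (S p) y). rewrite H2, (u_ratio (S p) y) by lia || easy.
          simpl. ring.
      + change (P (S p)) with (fun t => P p t * u lam (S p) t). rewrite <- (Rmult_1_l 1).
        now apply right_mult. }
  destruct (HP n (le_n n)) as [H1 H2]. rewrite <- (proj2 (H1 t Ht)). revert t Ht.
  destruct sol as (_&Hr0&_&Hrc&Hode).
  apply (constant_of_derive_0 T rho0 (fun t => rho t * P n t)).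
  - intros t Ht. destruct (H1 t Ht) as [H3 _]. destruct (Hode t Ht) as [_ H4].
    auto_derive; [repeat split; eexists; eassumption|]. rewrite_derive. unfold lamsum. ring.
  - replace rho0 with (rho 0 * 1) by (rewrite Hr0; ring). now apply right_mult.
Qed.

(** [u_1'' = (lam_1' + lam_1^2) u_1 = (k / n) (rho - cb) u_1], with [rho] eliminated by
    [rho_Qprod]. *)
Lemma u1_derive2 (t : R) : 0 < t < T -> 0 < Qprod W n (rad t) ->
  is_derive (fun t => lam 1%nat t * u lam 1 t) t
    (k * rho0 / INR n * u lam 1 t / (u lam 1 t ^ n * Qprod W n (rad t)) - k * cb / INR n * u lam 1 t).
Proof.
  intros Ht HQ. assert (Hn : INR n <> 0) by (apply not_0_INR; lia).
  assert (Hd := proj1 (u_facts 1 ltac:(lia)) t Ht).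
  assert (Hr := rho_Qprod t Ht).
  destruct sol as (_&_&_&_&Hode). assert (Ho := proj1 (Hode t Ht) 1%nat ltac:(lia)).
  auto_derive; [repeat split; eexists; eassumption|]. rewrite_derive.
  assert (Hu : u lam 1 t ^ n <> 0) by (apply pow_nonzero; pose proof (u_pos 1 t); lra).
  rewrite <- Hr. field. repeat split; easy || lra.
Qed.

End Reduction.

Theorem theorem3p7 (n J j : nat) (k cb rho0 tB : R) (lam0 : nat -> R)
    (lam : nat -> R -> R) (rho : R -> R) :
  (2 <= n)%nat -> 0 < k -> 0 < cb -> 0 < rho0 ->
  (1 <= J <= n)%nat ->
  (forall i, (1 <= i <= J)%nat -> lam0 i = lam0 1%nat) ->
  ((J < n)%nat -> lam0 J < lam0 (S J)) ->
  (forall i, (J < i < n)%nat -> lam0 i <= lam0 (S i)) ->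
  0 < tB ->
  maximal_sol n k cb rho0 lam0 tB lam rho ->
  (J < j <= n)%nat ->
  exists q p : R, 0 <= q /\ q <= p /\
    filterlim (fun t => Derive (u lam 1%nat) t * u lam j t) (at_left tB) (locally (- p)) /\
    filterlim (fun t => u lam 1%nat t * Derive (u lam j) t) (at_left tB) (locally q).
Proof.
  intros Hn Hk Hcb Hrho0 HJ Heq Hlt Hle HtB Hmax Hj.
  assert (sol := proj1 Hmax).
  assert (Hgt : forall i, (J < i <= n)%nat -> lam0 1%nat < lam0 i).
  { intros i. induction i as [|i IH]; [lia|]. intros Hi.
    destruct (Nat.eq_dec i J) as [->|Hne].
    - rewrite <- (Heq J) by lia. apply Hlt. lia.
    - apply Rlt_le_trans with (lam0 i); [apply IH|apply Hle]; lia. }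
  set (W := fun i => lam0 i - lam0 1%nat).
  set (x := u lam 1). set (x1 := fun t => lam 1%nat t * x t).
  set (rad := fun t => (u lam j t / u lam 1 t - 1) / W j).
  set (c := k * rho0 / INR n). set (cc := k * cb / INR n).
  assert (HINR : 0 < INR n) by (apply lt_0_INR; lia).
  assert (Hc : 0 < c) by (apply Rdiv_lt_0_compat; nra).
  assert (Hcc : 0 < cc) by (apply Rdiv_lt_0_compat; nra).
  assert (HWj : 0 < W j) by (unfold W; specialize (Hgt j Hj); lra).
  assert (Hj1 : (1 <= j <= n)%nat) by lia.
  assert (Hlamj := Hgt j Hj).
  assert (HQ : exists e A q, product_like (n - J) (Qprod W n) e A q).
  { assert (H := Qprod_product_like W J (n - J)).
    replace (J + (n - J))%nat with n in H by lia. apply H.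
    - intros i Hi. unfold W. rewrite Heq by easy. ring.
    - intros i Hi. unfold W. specialize (Hgt i ltac:(lia)). lra. }
  destruct HQ as (e & A & q & HQ).
  assert (Hloc : forall P : R -> Prop, (forall t, 0 < t < tB -> P t) -> at_left tB P).
  { intros P HP. apply at_left_iff. now exists 0. }
  assert (Hradp : forall t, 0 < t < tB -> 0 < rad t)
    by (apply (rad_pos n j k cb rho0 tB lam0 lam rho); easy || lia).
  assert (HQ1 : forall t, 0 < t < tB -> 1 <= Qprod W n (rad t)).
  { intros t Ht. destruct HQ as (_&_&H&_). apply (H (rad t)). now apply Hradp. }
  assert (Hxp : forall t, 0 < x t) by (intros; apply u_pos).
  assert (Hx : forall t, 0 < t < tB -> is_derive x t (x1 t)).
  { intros t Ht. apply (u_facts n k cb rho0 tB lam0 lam rho); easy || lia. }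
  assert (Hx1 : forall t, 0 < t < tB ->
    is_derive x1 t (c * x t / (x t ^ n * Qprod W n (rad t)) - cc * x t)).
  { intros t Ht. apply (u1_derive2 n j k cb rho0 tB lam0 lam rho); try easy; try lia.
    specialize (HQ1 t Ht). unfold rad, W in HQ1. lra. }
  assert (Hrad : forall t, 0 < t < tB -> is_derive rad t (/ x t ^ 2)).
  { apply (rad_derive n j k cb rho0 tB lam0 lam rho); easy || lia. }
  assert (Hratio : forall i t, (1 <= i <= n)%nat -> 0 < t < tB -> u lam i t = x t * (1 + W i * rad t)).
  { intros i t Hi Ht. apply (u_ratio n j k cb rho0 tB lam0 lam rho); easy || lia. }
  assert (Hwr : forall i t, (1 <= i <= n)%nat -> 0 < t < tB ->
    x t * u lam i t * (lam i t - lam 1%nat t) = W i).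
  { intros i t Hi Ht. apply (wronskian n j k cb rho0 tB lam0 lam rho); easy || lia. }
  assert (Hmon : forall s t, 0 < s < t -> t < tB -> rad s < rad t).
  { apply (rad_increasing n j k cb rho0 tB lam0 lam rho); easy || lia. }
  assert (HWi : forall i, (1 <= i <= n)%nat -> 0 <= W i).
  { intros i Hi. unfold W. destruct (Nat.le_gt_cases i J).
    - rewrite Heq by lia. lra.
    - specialize (Hgt i ltac:(lia)). lra. }
  assert (Hr0 : 0 < rad (tB / 2)) by (apply Hradp; lra).
  destruct (energy_bound tB c cc (rad (tB / 2)) n (n - J) (Qprod W n) e A q x x1 rad) as [B HB];
    try easy; try (apply Hloc; easy).
  { apply at_left_iff. exists (tB / 2). split; [lra|]. intros t Ht. left. apply Hmon; lra. }
  destruct (bounded_derive_tends tB B x x1) as [xl Hxl]; [now apply Hloc| |].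
  { revert HB. apply filter_imp. now intros t [_ H]. }
  assert (Hxl0 : 0 <= xl).
  { apply Rnot_lt_le. intros H. apply (at_left_false tB). generalize (tends_lt tB x xl 0 Hxl H).
    apply filter_imp. intros t Ht. specialize (Hxp t). lra. }
  destruct (Req_dec xl 0) as [Hz|Hnz].
  2: {
    (* Without collapse all unknowns converge, so the solution extends past [tB]. *)
    exfalso. assert (Hpos : 0 < xl) by lra.
    assert (Hxlo := tends_gt tB x xl (xl / 2) Hxl ltac:(lra)).
    destruct (bounded_derive_tends tB (/ (xl / 2) ^ 2) rad (fun t => / x t ^ 2)) as [rl Hrl];
      [now apply Hloc| |].
    { revert Hxlo. apply filter_imp. intros t Ht.
      rewrite Rabs_pos_eq by (left; apply Rinv_0_lt_compat, pow_lt, Hxp).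
      apply Rinv_le_contravar; [apply pow_lt; lra|apply pow_incr; lra]. }
    assert (Hrlp : 0 < rl).
    { apply Rlt_le_trans with (rad (tB / 2)); [easy|]. apply Rnot_lt_le. intros H.
      apply (at_left_false tB).
      generalize (filter_and _ _ (tends_lt tB rad rl _ Hrl H) (at_left_self tB (tB / 2) ltac:(lra))).
      apply filter_imp. intros t [H1 H2]. specialize (Hmon (tB / 2) t ltac:(lra) ltac:(lra)). lra. }
    destruct (bounded_derive_tends tB (c * B / (xl / 2) ^ n + cc * B) x1
      (fun t => c * x t / (x t ^ n * Qprod W n (rad t)) - cc * x t)) as [x1l Hx1l]; [now apply Hloc| |].
    { generalize (filter_and _ _ Hxlo (filter_and _ _ HB (at_left_self tB 0 HtB))).
      apply filter_imp. intros t (H1&[H2 _]&H3). specialize (HQ1 t H3). specialize (Hxp t).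
      assert (Hpl : 0 < (xl / 2) ^ n) by (apply pow_lt; lra).
      assert (Hpi : (xl / 2) ^ n <= x t ^ n) by (apply pow_incr; lra).
      assert (Hd : (xl / 2) ^ n <= x t ^ n * Qprod W n (rad t)) by nra.
      assert (0 <= c * x t / (x t ^ n * Qprod W n (rad t)) <= c * B / (xl / 2) ^ n).
      { split; [apply Rmult_le_pos; [nra|left; apply Rinv_0_lt_compat; lra]|].
        unfold Rdiv. apply Rmult_le_compat; [nra|left; apply Rinv_0_lt_compat; lra|nra|].
        apply Rinv_le_contravar; easy. }
      assert (0 <= cc * x t <= cc * B) by nra.
      apply Rabs_le. lra. }
    assert (Hinv : forall (f : R -> R) l, l <> 0 -> tends tB f l -> tends tB (fun t => / f t) (/ l)).
    { intros f l Hl Hf. apply (tends_continuous tB f Rinv); [now apply continuous_Rinv|easy]. }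
    assert (Hlam1 : tends tB (lam 1%nat) (x1l * / xl)).
    { apply (tends_ext tB (fun t => x1 t * / x t)).
      - apply Hloc. intros t Ht. unfold x1. field. specialize (Hxp t). lra.
      - apply tends_mult; [easy|]. apply Hinv; easy. }
    (* The limits are read off from [lam_i = lam_1 + W_i / (u_1 u_i)] and from the conservation law
       for [rho]; [W_i >= 0] keeps the denominators positive. *)
    apply (maximal_no_limit n k cb rho0 tB lam0 lam rho
      (fun i => x1l * / xl + W i * / (xl * (xl * (1 + W i * rl))))
      (rho0 * / (xl ^ n * Qprod W n rl))); try easy.
    - intros i Hi. specialize (HWi i Hi).
      apply (tends_ext tB (fun t => lam 1%nat t + W i * / (x t * (x t * (1 + W i * rad t))))).
      + apply Hloc. intros t Ht. rewrite <- Hratio by easy. rewrite <- (Hwr i t) by easy.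
        field. split; apply Rgt_not_eq; [apply u_pos|apply Hxp].
      + apply tends_plus; [easy|]. apply tends_scal, Hinv.
        * apply Rgt_not_eq. repeat apply Rmult_lt_0_compat; try easy. nra.
        * apply tends_mult; [easy|]. apply tends_mult; [easy|].
          apply tends_plus; [apply tends_const|now apply tends_scal].
    - destruct HQ as (_&_&HQ&_). destruct (HQ rl Hrlp) as (HQl&_&_&HQd).
      apply (tends_ext tB (fun t => rho0 * / (x t ^ n * Qprod W n (rad t)))).
      + apply Hloc. intros t Ht.
        assert (Hrho : rho t * (x t ^ n * Qprod W n (rad t)) = rho0)
          by (apply (rho_Qprod n j k cb rho0 tB lam0 lam rho); easy || lia).
        rewrite <- Hrho. specialize (HQ1 t Ht).
        assert (x t ^ n <> 0) by (apply pow_nonzero; specialize (Hxp t); lra).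
        field. split; [lra|easy].
      + apply tends_scal, Hinv.
        * apply Rgt_not_eq, Rmult_lt_0_compat; [now apply pow_lt|lra].
        * apply tends_mult.
          -- apply (tends_continuous tB x (fun y => y ^ n)); [|easy].
             apply (ex_derive_continuous (fun y => y ^ n)). auto_derive. easy.
          -- apply (tends_continuous tB rad (Qprod W n)); [|easy].
             apply (ex_derive_continuous (Qprod W n)). eexists. exact HQd. }
  rewrite Hz in Hxl.
  (* A bounded velocity and [x -> 0] give [x <= B' (tB - t)], so [rad' >= 1 / (B' (tB - t))^2],
     whose integral diverges at [tB]. *)
  assert (Hradinf : forall M, at_left tB (fun t => M < rad t)).
  { intros M.
    assert (HB' : at_left tB (fun t => x t <= Rabs B + 1 /\ Rabs (x1 t) <= Rabs B + 1)).
    { revert HB. apply filter_imp. intros t Ht. pose proof (Rle_abs B). lra. }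
    set (B' := Rabs B + 1) in *. assert (HB0 : 0 < B') by (unfold B'; pose proof (Rabs_pos B); lra).
    destruct (proj1 (at_left_iff _ _) (filter_and _ _ HB' (at_left_self tB 0 HtB))) as [a [Hab Ha]].
    assert (Hlip : forall t, a < t < tB -> x t <= B' * (tB - t)).
    { intros t Ht. apply Rnot_lt_le. intros H. apply (at_left_false tB).
      generalize (filter_and _ _ (tends_lt tB x 0 _ Hxl (proj2 (Rlt_0_minus _ _) H)) (at_left_self tB t ltac:(lra))).
      apply filter_imp. intros y [H1 H2].
      assert (- x y - B' * y <= - x t - B' * t).
      { apply (nonincreasing_of_derive a tB (fun t => - x t - B' * t) (fun t => - x1 t - B' * 1)); try lra;
          intros v Hv; destruct (Ha v Hv) as [[_ H3%Rabs_le_between] H4].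
        - apply (is_derive_minus (V := R_NormedModule));
            [apply (is_derive_opp (V := R_NormedModule)); now apply Hx|].
          apply is_derive_scal, (is_derive_id (K := R_AbsRing)).
        - lra. }
      assert (B' * y < B' * tB) by (apply Rmult_lt_compat_l; lra). lra. }
    set (a0 := (a + tB) / 2).
    set (C := / (B' ^ 2 * (tB - a0)) - rad a0).
    assert (HB2 : 0 < B' ^ 2) by now apply pow_lt.
    assert (Hlow : forall t, a0 < t < tB -> / (B' ^ 2 * (tB - t)) - C <= rad t).
    { intros t Ht.
      cut (/ (B' ^ 2 * (tB - t)) - rad t <= / (B' ^ 2 * (tB - a0)) - rad a0); [unfold C; lra|].
      apply (nonincreasing_of_derive a tB (fun t => / (B' ^ 2 * (tB - t)) - rad t)
        (fun t => / (B' ^ 2 * (tB - t) ^ 2) - / x t ^ 2)); try (unfold a0 in *; lra); intros v Hv.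
      - apply (is_derive_minus (V := R_NormedModule)); [|apply Hrad; now apply Ha].
        auto_derive; [apply Rgt_not_eq; nra|]. field. split; lra.
      - assert (/ (B' ^ 2 * (tB - v) ^ 2) <= / x v ^ 2); [|lra].
        apply Rinv_le_contravar; [apply pow_lt, Hxp|].
        rewrite <- Rpow_mult_distr. apply pow_incr. split; [left; apply Hxp|now apply Hlip]. }
    set (M' := Rabs (M + C) + 1).
    assert (HM' : 0 < M') by (unfold M'; pose proof (Rabs_pos (M + C)); lra).
    assert (Hiv : 0 < / (B' ^ 2 * M')) by (apply Rinv_0_lt_compat, Rmult_lt_0_compat; easy).
    assert (H1 := at_left_self tB a0 ltac:(unfold a0; lra)).
    assert (H2 := at_left_self tB (tB - / (B' ^ 2 * M')) ltac:(lra)).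
    generalize (filter_and _ _ H1 H2). clear H1 H2.
    apply filter_imp. intros t [H1 H2]. specialize (Hlow t H1).
    assert (M' <= / (B' ^ 2 * (tB - t))).
    { rewrite <- (Rinv_inv M'). apply Rinv_le_contravar; [apply Rmult_lt_0_compat; lra|].
      replace (/ M') with (B' ^ 2 * / (B' ^ 2 * M')) by (field; lra).
      apply Rmult_le_compat_l; lra. }
    pose proof (Rle_abs (M + C)). unfold M' in *. lra. }
  destruct (collapse_limit tB c cc n (n - J) (Qprod W n) e A q x x1 rad) as (beta & Hbeta & Hlim);
    try easy; try lia; try (apply Hloc; easy).
  exists (W j * (1 - beta)), (W j * beta).
  split; [nra|]. split; [nra|].
  assert (Hxx1 : tends tB (fun t => x t * x1 t) 0).
  { apply (tends_ext tB (fun t => - (x t * x1 t * rad t) * (-1 * / rad t))).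
    - apply Hloc. intros t Ht. specialize (Hradp t Ht). field. lra.
    - replace 0 with (beta * (-1 * 0)) by ring. apply tends_mult; [easy|].
      apply tends_scal. now apply tends_inv_infty. }
  assert (Hmain : tends tB (fun t => x1 t * u lam j t) (- (W j * beta))).
  { apply (tends_ext tB (fun t => x t * x1 t + (- W j) * - (x t * x1 t * rad t))).
    - apply Hloc. intros t Ht. rewrite (Hratio j t) by easy. ring.
    - replace (- (W j * beta)) with (0 + - W j * beta) by ring.
      apply tends_plus; [easy|]. now apply tends_scal. }
  split; apply tends_filterlim.
  - apply (tends_ext tB (fun t => x1 t * u lam j t)); [|easy].
    apply Hloc. intros t Ht. fold x. now rewrite (is_derive_unique _ _ _ (Hx t Ht)).
  - apply (tends_ext tB (fun t => W j + x1 t * u lam j t)).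
    + apply Hloc. intros t Ht.
      assert (Hd := proj1 (u_facts n k cb rho0 tB lam0 lam rho HtB sol j Hj1) t Ht).
      rewrite (is_derive_unique _ _ _ Hd). rewrite <- (Hwr j t) by easy. unfold x1, x. ring.
    + replace (W j * (1 - beta)) with (W j + - (W j * beta)) by ring.
      apply tends_plus; [apply tends_const|easy].
Qed.
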